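(* Let $\Bbbk$ be an algebraically closed field, $Q$ a finite quiver, $\mathcal{I}$ a semi-monomial ideal in $\Bbbk Q$ and $\Lambda=\Bbbk Q/\mathcal{I}$. Let $\mathbf{F}=(F,L)$ and $\mathbf{F'}=(F',L')$ be linear shapes over $Q$, and let $\mathbf{G}=(G,Z)$ and $\mathbf{G'}=(G',Z')$ be non-isomorphic cyclic shapes over $Q$, all compatible with $\mathcal{I}$. Let $\gamma\in Z_1$, $\gamma'\in Z'_1$, let $\lambda,\mu\in\Bbbk\setminus\{0\}$ and let $s,t$ be positive integers. Then the following isomorphisms of $\Lambda$-modules hold: \[ S_{\mathbf{F}}\otimes S_{\mathbf{F'}}\cong\bigoplus_{\mathbf{H}\in\mathcal{L}(\mathbf{F},\mathbf{F'})}S_{\mathbf{H}}, \] \[ S_{\mathbf{F}}\otimes B_{\mathbf{G}}(\lambda,s,\gamma)\cong\bigoplus_{\mathbf{H}\in\mathcal{L}(\mathbf{F},\mathbf{G})}s\,S_{\mathbf{H}}, \] \[ B_{\mathbf{G}}(\lambda,s,\gamma)\otimes B_{\mathbf{G'}}(\mu,t,\gamma')\cong\bigoplus_{\mathbf{H}\in\mathcal{L}(\mathbf{G},\mathbf{G'})}st\,S_{\mathbf{H}}, \] \[ B_{\mathbf{G}}(\lambda,s,\gamma)\otimes B_{\mathbf{G}}(\mu,t,\gamma)\cong\bigoplus_{k\in I_{st}}B_{\mathbf{G}}(\lambda\mu,l_k,\gamma)\ \oplus\bigoplus_{\mathbf{H}\in\mathcal{L}(\mathbf{G},\mathbf{G})}st\,S_{\mathbf{H}}.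 \]
   Context: Quivers and modules. A quiver $Q$ consists of finite sets $Q_0$ (vertices), $Q_1$ (arrows) and maps $t,h:Q_1\to Q_0$ (tail, head); $Q_1(x,y)$ is the set of arrows from $x$ to $y$. The path category $\Bbbk Q$ is the $\Bbbk$-linear category with object set $Q_0$ whose morphism space from $x$ to $y$ has the paths from $x$ to $y$ (including the trivial path $e_x$ if $x=y$) as basis, with composition by concatenation. An ideal $\mathcal{I}$ of $\Bbbk Q$ is semi-monomial if it is generated by zero relations (paths) and commutativity relations (differences of two paths with the same start and the same end). For a small $\Bbbk$-linear category $\mathcal{A}$, $\mathrm{mod}\,\mathcal{A}$ is the category of $\Bbbk$-linear functors $m$ from $\mathcal{A}$ to vector spaces with all $m(x)$ finite dimensional; $\mathrm{mod}\,\Lambda$ is identified with the modules in $\mathrm{mod}\,\Bbbk Q$ vanishing on $\mathcal{I}$. The tensor product is defined by $(m\otimes n)(x)=m(x)\otimes n(x)$ and $(m\otimes n)(\alpha)=m(\alpha)\otimes n(\alpha)$ for vertices $x$ and arrows $\alpha$ (for semi-monomial $\mathcal{I}$ the tensor product of $\Lambda$-modules is a $\Lambda$-module). For a module $m$ and positive integer $d$, $d\,m$ denotes the direct sum of $d$ copies of $m$. Wrappings and shapes. A linear functor $F:\Bbbk P\to\Bbbk Q$ is a wrapping if it maps arrows to arrows and induces injective maps $P_1(x,y)\to Q_1(Fx,Fy)$ for all $x,y\in P_0$ (so it is induced by a quiver morphism). It is strict if for all distinct arrows $\alpha:x\to y$, $\alpha':x'\to y'$ of $P$, $F\alpha=F\alpha'$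 implies $x\ne x'$ and $y\ne y'$. A shape over $Q$ is a pair $\mathbf{F}=(F,P)$ with $P$ a quiver and $F:\Bbbk P\to\Bbbk Q$ a strict wrapping. Shapes $(F_1,P^1)$, $(F_2,P^2)$ are isomorphic if there is a quiver isomorphism $\sigma:P^1\to P^2$ with $F_1=F_2\circ\sigma$. The wrapping $F$ (or the shape $\mathbf{F}$) is compatible with $\mathcal{I}$ if all elements of $\mathcal{I}$ can be written as linear combinations of paths not of the form $F\gamma$ with $\gamma$ a path in $P$. Push-down. For a wrapping $F:\Bbbk P\to\Bbbk Q$ and $m\in\mathrm{mod}\,\Bbbk P$, $F_*m\in\mathrm{mod}\,\Bbbk Q$ is given by $(F_*m)(x')=\bigoplus_{Fx=x'}m(x)$, and for an arrow $\alpha':x'\to y'$, $(F_*m)(\alpha')$ is the linear map whose component from $m(x)$ to $m(y)$ is $m(\alpha)$ if there is an arrow $\alpha\in P_1(x,y)$ with $F\alpha=\alpha'$, and $0$ otherwise. If $F$ is compatible with $\mathcal{I}$ then $F_*m$ is a $\Lambda$-module. Strings. A quiver is linear if its underlying graph is of Dynkin type $\mathbb{A}_n$ ($n\ge1$ vertices); a shape $(F,L)$ is linear if $L$ is. $\chi_L$ is the $\Bbbk L$-module with $\chi_L(x)=\Bbbk$ for every vertex and $\chi_L(\alpha)=1_\Bbbk$ for every arrow. The string of a linear shape is $S_{\mathbf{F}}=F_*\chi_L$. Bands. A quiver is cyclic if its underlying graph is of extended Dynkin type $\tilde{\mathbb{A}}$ (a single cycle; the one-loop quiver is included). A shape $\mathbf{G}=(G,Z)$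 is cyclic if $Z$ is cyclic and $\mathbf{G}$ has trivial automorphism group. For $\gamma\in Z_1$, $\lambda\in\Bbbk\setminus\{0\}$, $s>0$, let $B=B(\lambda,s,\gamma)$ be the $\Bbbk Z$-module with $B(x)=\Bbbk^s$ for all $x\in Z_0$, $B(\alpha)=1_{\Bbbk^s}$ for $\alpha\neq\gamma$, and $B(\gamma)=J_\lambda(s)$, the $s\times s$ upper triangular Jordan block with eigenvalue $\lambda$. The band is $B_{\mathbf{G}}(\lambda,s,\gamma)=G_*B(\lambda,s,\gamma)$. The numbers $l_k$. $(l_k)_{k\in I_{st}}$ is the non-increasing finite sequence of positive integers determined by $J_\lambda(s)\otimes J_\mu(t)\cong\bigoplus_{k\in I_{st}}J_{\lambda\mu}(l_k)$ (Jordan normal form of the Kronecker product, for $\lambda,\mu\neq0$). The sets $\mathcal{L}(\cdot,\cdot)$. For shapes $\mathbf{F}=(F,P)$, $\mathbf{F'}=(F',P')$ over $Q$, the fibre product $P\times P'$ is the quiver with vertices $\{(x,x')\in P_0\times P'_0: Fx=F'x'\}$, arrows $\{(\alpha,\alpha')\in P_1\times P'_1: F\alpha=F'\alpha'\}$, and componentwise tails and heads; $\Pi_1,\Pi_2$ are the projection wrappings to $\Bbbk P$ and $\Bbbk P'$. Let $\{P^j\}_{j\in J}$ be the connected components of $P\times P'$ and $\mathbf{H}_j=(F\Pi_1|_{P^j},P^j)$. Then $\mathcal{L}(\mathbf{F},\mathbf{F'})$ is the family of those $\mathbf{H}_j$ that are linear (one member for each linear connected component, so isomorphic shapes may occur repeatedly).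 *)

(* Defs.v *)
From HB Require Import structures.
From mathcomp Require Import all_boot all_order all_algebra.
From mathcomp Require Import finmap.
From mathcomp.real_closed Require Import mxtens.
From mathcomp.multinomials Require Import monalg.
From mathcomp.classical Require Import boolp.

Set Implicit Arguments.
Unset Strict Implicit.
Unset Printing Implicit Defensive.

Import GRing.Theory VectorInternalTheory.
Local Open Scope ring_scope.

Definition dsum (K : fieldType) (I : finType) (V : I -> vectType K) : Type :=
  {dffun forall i, V i}.

Section DirectSumSpace.
Variables (K : fieldType) (I : finType) (V : I -> vectType K).

HB.instance Definition _ := Choice.copy (dsum V) {dffun forall i, V i}.

Definition mk_dsum (f : forall i, V i) : dsum V := [ffun i => f i].

Lemma mk_dsumE f i : mk_dsum f i = f i.
Proof. by rewrite ffunE. Qed.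

Lemma dsumP (f g : dsum V) : (forall i, f i = g i) <-> f = g.
Proof. by split=> [e|->//]; apply/ffunP. Qed.

Let add (f g : dsum V) := mk_dsum (fun i => f i + g i).
Let opp (f : dsum V) := mk_dsum (fun i => - f i).
Let zero := mk_dsum (fun i => 0).
Let scale (a : K) (f : dsum V) := mk_dsum (fun i => a *: f i).

Fact dsum_addA : associative add.
Proof. by move=> f g h; apply/dsumP => i; rewrite !mk_dsumE addrA. Qed.
Fact dsum_addC : commutative add.
Proof. by move=> f g; apply/dsumP => i; rewrite !mk_dsumE addrC. Qed.
Fact dsum_add0 : left_id zero add.
Proof. by move=> f; apply/dsumP => i; rewrite !mk_dsumE add0r. Qed.
Fact dsum_addN : left_inverse zero opp add.
Proof. by move=> f; apply/dsumP => i; rewrite !mk_dsumE addNr. Qed.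
HB.instance Definition _ :=
  GRing.isZmodule.Build (dsum V) dsum_addA dsum_addC dsum_add0 dsum_addN.

Fact dsum_scaleA a b f : scale a (scale b f) = scale (a * b) f.
Proof. by apply/dsumP => i; rewrite !mk_dsumE scalerA. Qed.
Fact dsum_scale1 : left_id 1 scale.
Proof. by move=> f; apply/dsumP => i; rewrite !mk_dsumE scale1r. Qed.
Fact dsum_scaleDr : right_distributive scale +%R.
Proof. by move=> a f g; apply/dsumP => i; rewrite !mk_dsumE scalerDr. Qed.
Fact dsum_scaleDl f : {morph scale^~ f : a b / a + b}.
Proof. by move=> a b; apply/dsumP => i; rewrite !mk_dsumE scalerDl. Qed.
HB.instance Definition _ := GRing.Zmodule_isLmodule.Build K (dsum V)
  dsum_scaleA dsum_scale1 dsum_scaleDr dsum_scaleDl.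

Lemma dsumD (f g : dsum V) i : (f + g) i = f i + g i.
Proof. exact: mk_dsumE. Qed.
Lemma dsumZ a (f : dsum V) i : (a *: f) i = a *: f i.
Proof. exact: mk_dsumE. Qed.

Let d (k : 'I_#|I|) := dim (V (enum_val k)).

Fact dsum_vect_iso : Vector.axiom (\sum_k d k) (dsum V).
Proof.
pose torow (f : dsum V) : 'rV[K]_(\sum_k d k) :=
  \mxrow_(k < #|I|) (v2r (f (enum_val k)) : 'rV_(d k)).
pose ofrow (w : 'rV[K]_(\sum_k d k)) : dsum V := mk_dsum (fun i =>
  eq_rect _ V (@r2v K (V _) (submxrow w (enum_rank i))) _ (enum_rankK i)).
exists torow => [a f g|]; last exists ofrow => [f|w].
- apply/mxrowP => k; rewrite submxrowD mxrowK.
  rewrite [submxrow (a *: _) k](_ : _ = a *: submxrow (torow f) k); last first.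
    by apply/matrixP => r c; rewrite !mxE.
  rewrite !mxrowK. by rewrite dsumD dsumZ linearP.
- apply/dsumP => i; rewrite mk_dsumE mxrowK v2rK.
  by have e j (ij : j = i) : eq_rect j V (f j) i ij = f i by case: _ / ij.
- apply/mxrowP => k; rewrite mxrowK mk_dsumE.
  have h j (e : enum_val j = enum_val k) : j = k ->
      v2r (eq_rect _ V (@r2v K (V _) (submxrow w j)) _ e) = submxrow w k.
    by move=> jk; case: _ / jk in e *; rewrite eq_axiomK /= r2vK.
  exact/h/enum_valK.
Qed.
HB.instance Definition _ :=
  Lmodule_hasFinDim.Build K (dsum V) dsum_vect_iso.
End DirectSumSpace.

Section DirectSumMap.
Variables (K : fieldType) (I J : finType).
Variables (V : I -> vectType K) (W : J -> vectType K).
Variable f : forall i j, 'Hom(V i, W j).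

Let map (v : dsum V) : dsum W := mk_dsum (fun j => \sum_i f i j (v i)).

Fact dsum_map_linear : linear map.
Proof.
move=> a u v; apply/dsumP => j; rewrite dsumD dsumZ !mk_dsumE.
rewrite scaler_sumr -big_split; apply: eq_bigr => i _.
by rewrite dsumD dsumZ linearP.
Qed.
HB.instance Definition _ := GRing.isLinear.Build K (dsum V) (dsum W) _ map
  dsum_map_linear.

Definition dsum_lfun : 'Hom(dsum V, dsum W) := linfun map.

Lemma dsum_lfunE v j : dsum_lfun v j = \sum_i f i j (v i).
Proof. by rewrite lfunE /= mk_dsumE. Qed.
End DirectSumMap.

Section DirectSumDiag.
Variables (K : fieldType) (I : finType) (V W : I -> vectType K).
Variable f : forall i, 'Hom(V i, W i).

Let map (v : dsum V) : dsum W := mk_dsum (fun i => f i (v i)).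

Fact dsum_diag_linear : linear map.
Proof.
by move=> a u v; apply/dsumP => i; rewrite !(dsumD, dsumZ, mk_dsumE) linearP.
Qed.
HB.instance Definition _ := GRing.isLinear.Build K (dsum V) (dsum W) _ map
  dsum_diag_linear.

Definition dsum_diag : 'Hom(dsum V, dsum W) := linfun map.

Lemma dsum_diagE v i : dsum_diag v i = f i (v i).
Proof. by rewrite lfunE /= mk_dsumE. Qed.
End DirectSumDiag.

Section PairMap.
Variables (K : fieldType) (V1 V2 W1 W2 : vectType K).
Variables (f1 : 'Hom(V1, W1)) (f2 : 'Hom(V2, W2)).

Let map (v : V1 * V2) : W1 * W2 := (f1 v.1, f2 v.2).

Fact pair_map_linear : linear map.
Proof. by move=> a u v; rewrite /map /= !linearP. Qed.
HB.instance Definition _ := GRing.isLinear.Build K (V1 * V2)%type (W1 * W2)%type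
  _ map pair_map_linear.

Definition pair_lfun : 'Hom((V1 * V2)%type, (W1 * W2)%type) := linfun map.

Lemma pair_lfunE v : pair_lfun v = (f1 v.1, f2 v.2).
Proof. by rewrite lfunE. Qed.
End PairMap.

(** The tensor product is realized in coordinates: [u ⊗ v] is the rank-one
    matrix of products of coordinates. [tensor_lfunE] and [tensor_universal]
    characterize it independently of coordinates. *)
Definition tensor (K : fieldType) (U V : vectType K) : vectType K :=
  'M[K]_(dim U, dim V).

Section Tensor.
Variable K : fieldType.

Definition tens (U V : vectType K) (u : U) (v : V) : tensor U V :=
  (v2r u)^T *m v2r v.

Definition tensor_lfun (U V U' V' : vectType K)
    (f : 'Hom(U, U')) (g : 'Hom(V, V')) : 'Hom(tensor U V, tensor U' V') :=
  linfun (mulmx (f2mx f)^T \o mulmxr (f2mx g)).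

Lemma tensor_lfunE (U V U' V' : vectType K)
    (f : 'Hom(U, U')) (g : 'Hom(V, V')) (u : U) (v : V) :
  tensor_lfun f g (tens u v) = tens (f u) (g v).
Proof.
rewrite lfunE /tens /= unlock /= !r2vK.
by rewrite trmx_mul !mulmxA.
Qed.

Lemma tens_linearl (U V : vectType K) (v : V) : linear (fun u : U => tens u v).
Proof.
move=> a u u'; rewrite /tens linearP /= linearP /=.
by rewrite mulmxDl -scalemxAl.
Qed.

Lemma tens_linearr (U V : vectType K) (u : U) : linear (tens u : V -> _).
Proof. by move=> a v v'; rewrite /tens linearP /= mulmxDr -scalemxAr. Qed.

Let bas (U : vectType K) (i : 'I_(dim U)) : U := r2v (delta_mx 0 i).

Let basE (U : vectType K) (u : U) : u = \sum_i v2r u 0 i *: bas i.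
Proof.
apply: (can_inj v2rK); rewrite linear_sum [LHS]row_sum_delta.
by apply: eq_bigr => i _; rewrite linearZ /= r2vK.
Qed.

Let tens_bas (U V : vectType K) (i : 'I_(dim U)) (j : 'I_(dim V)) :
  tens (bas i) (bas j) = delta_mx i j.
Proof. by rewrite /tens !r2vK trmx_delta mul_delta_mx. Qed.

Lemma tensor_universal (U V W : vectType K) (b : U -> V -> W) :
    (forall v, linear (b^~ v)) -> (forall u, linear (b u)) ->
  exists! h : 'Hom(tensor U V, W), forall u v, h (tens u v) = b u v.
Proof.
move=> bl br.
have sumE (h : tensor U V -> W) : linear h ->
    forall A : 'M_(_, _), h A = \sum_i \sum_j A i j *: h (delta_mx i j).
  move=> lh A; pose H := GRing.isLinear.Build _ _ _ _ h lh.
  pose hl : {linear tensor U V -> W} := HB.pack h H.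
  rewrite -[LHS]/(hl A) [A in LHS]matrix_sum_delta linear_sum.
  apply: eq_bigr => i _; rewrite linear_sum.
  by apply: eq_bigr => j _; rewrite linearZ.
have bE u v : b u v =
    \sum_i \sum_j (v2r u 0 i * v2r v 0 j) *: b (bas i) (bas j).
  pose Hl v := GRing.isLinear.Build _ _ _ _ _ (bl v).
  pose Hr u := GRing.isLinear.Build _ _ _ _ _ (br u).
  pose L v : {linear U -> W} := HB.pack (b^~ v) (Hl v).
  pose R u : {linear V -> W} := HB.pack (b u) (Hr u).
  rewrite -[LHS]/(L v u) [u in LHS]basE linear_sum; apply: eq_bigr => i _.
  rewrite linearZ /= -[b _ v]/(R (bas i) v) [v in LHS]basE linear_sum.
  rewrite scaler_sumr; apply: eq_bigr => j _.
  by rewrite linearZ /= scalerA.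
pose h0 (A : tensor U V) : W :=
  \sum_i \sum_j (A : 'M_(_, _)) i j *: b (bas i) (bas j).
have h0l : linear h0.
  move=> a A B; rewrite /h0 scaler_sumr -big_split; apply: eq_bigr => i _.
  rewrite scaler_sumr -big_split; apply: eq_bigr => j _.
  by rewrite !mxE scalerDl scalerA.
pose H0 := GRing.isLinear.Build _ _ _ _ h0 h0l.
pose hl : {linear tensor U V -> W} := HB.pack h0 H0.
exists (linfun hl); split=> [u v|h hP].
  rewrite lfunE /= /h0 [RHS]bE; apply: eq_bigr => i _; apply: eq_bigr => j _.
  by rewrite /tens mxE big_ord1 mxE.
apply/lfunP => A; rewrite lfunE /= /h0.
rewrite (sumE h (linearP h)); apply: eq_bigr => i _; apply: eq_bigr => j _.
by rewrite -tens_bas hP.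
Qed.
End Tensor.

Record quiver := Quiver {
  vertex : finType;
  arrow : finType;
  qtail : arrow -> vertex;
  qhead : arrow -> vertex }.

(** [Q_1(x, y)], the arrows from [x] to [y]. *)
Definition arr (Q : quiver) (x y : vertex Q) : finType :=
  {a : arrow Q | (qtail a == x) && (qhead a == y)}.

(** A linear functor between path categories mapping arrows to arrows amounts to a
    quiver morphism; [path_map] is its action on paths. *)
Record qhom (P Q : quiver) := QHom {
  on_vertex :> vertex P -> vertex Q;
  on_arrow : arrow P -> arrow Q;
  qhom_tail : forall a, qtail (on_arrow a) = on_vertex (qtail a);
  qhom_head : forall a, qhead (on_arrow a) = on_vertex (qhead a) }.

Section Functor.
Variables (P Q : quiver) (F : qhom P Q).

Fact on_arr_subproof x y (a : arr x y) :
  (qtail (on_arrow F (val a)) == F x) && (qhead (on_arrow F (val a)) == F y).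
Proof.
by rewrite qhom_tail qhom_head; case/andP: (valP a) => /eqP-> /eqP->; rewrite !eqxx.
Qed.
Definition on_arr x y (a : arr x y) : arr (F x) (F y) :=
  Sub (on_arrow F (val a)) (on_arr_subproof a).
End Functor.

Definition qhom_comp (P Q R : quiver) (G : qhom Q R) (F : qhom P Q) : qhom P R.
Proof.
exists (G \o F) (on_arrow G \o on_arrow F) => a /=.
- by rewrite !qhom_tail.
- by rewrite !qhom_head.
Defined.

(** Equality of the induced functors, without function extensionality. *)
Definition qhom_eq (P Q : quiver) (F G : qhom P Q) : Prop :=
  F =1 G /\ on_arrow F =1 on_arrow G.

Definition qhom_iso (P Q : quiver) (F : qhom P Q) : Prop :=
  bijective F /\ bijective (on_arrow F).

Inductive qpath (Q : quiver) : vertex Q -> vertex Q -> Type :=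
| pnil x : qpath x x
| pcons x y z (a : arr x y) (p : qpath y z) : qpath x z.

HB.instance Definition _ Q x y := gen_eqMixin (@qpath Q x y).
HB.instance Definition _ Q x y := gen_choiceMixin (@qpath Q x y).

Fixpoint pcat (Q : quiver) (x y z : vertex Q) (p : qpath x y) :
    qpath y z -> qpath x z :=
  match p with
  | pnil _ => fun q => q
  | pcons _ _ _ a p' => fun q => pcons a (pcat p' q)
  end.

Fixpoint path_map (P Q : quiver) (F : qhom P Q) (x y : vertex P) (p : qpath x y) :
    qpath (F x) (F y) :=
  match p with
  | pnil x => pnil (F x)
  | pcons _ _ _ a p' => pcons (on_arr F a) (path_map F p')
  end.

Inductive in_path_map (P Q : quiver) (F : qhom P Q) :
    forall x y : vertex Q, qpath x y -> Prop :=
| InPathMap x y (g : qpath x y) : in_path_map F (path_map F g).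

(** The space of morphisms from [x] to [y] in the [K]-linear path category. *)
Definition kpath (K : fieldType) (Q : quiver) (x y : vertex Q) : lmodType K :=
  {malg K[qpath x y]}.

(** The bilinear extension of concatenation: [u] first, then [v]. *)
Definition kcomp (K : fieldType) (Q : quiver) (x y z : vertex Q)
    (u : kpath K x y) (v : kpath K y z) : kpath K x z :=
  \sum_(p <- msupp u) \sum_(q <- msupp v) (u@_p * v@_q) *: << pcat p q >>.

Record ideal (K : fieldType) (Q : quiver) := Ideal {
  in_ideal :> forall x y : vertex Q, kpath K x y -> Prop;
  ideal0 : forall x y, in_ideal (0 : kpath K x y);
  idealD : forall x y (u v : kpath K x y),
    in_ideal u -> in_ideal v -> in_ideal (u + v);
  idealZ : forall x y (c : K) (u : kpath K x y), in_ideal u -> in_ideal (c *: u);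
  ideal_compl : forall x y z (u : kpath K x y) (v : kpath K y z),
    in_ideal v -> in_ideal (kcomp u v);
  ideal_compr : forall x y z (u : kpath K x y) (v : kpath K y z),
    in_ideal u -> in_ideal (kcomp u v) }.

Section SemiMonomial.
Variables (K : fieldType) (Q : quiver).

Definition generates (R : forall x y : vertex Q, kpath K x y -> Prop)
    (I : ideal K Q) : Prop :=
  (forall x y (u : kpath K x y), R x y u -> I x y u) /\
  (forall J : ideal K Q, (forall x y (u : kpath K x y), R x y u -> J x y u) ->
     forall x y (u : kpath K x y), I x y u -> J x y u).

Definition zero_relation (x y : vertex Q) (u : kpath K x y) : Prop :=
  exists p : qpath x y, u = << p >>.

Definition commutativity_relation (x y : vertex Q) (u : kpath K x y) : Prop :=
  exists p q : qpath x y, u = << p >> - << q >>.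

Definition semi_monomial (I : ideal K Q) : Prop :=
  exists2 R : forall x y : vertex Q, kpath K x y -> Prop,
    forall x y (u : kpath K x y), R x y u ->
      zero_relation u \/ commutativity_relation u
    & generates R I.
End SemiMonomial.

(** As the path category is free, a linear functor on it is given by its values
    on vertices and arrows; [on_path] and [on_kpath] extend it to morphisms. *)
Record qmod (K : fieldType) (Q : quiver) := QMod {
  space :> vertex Q -> vectType K;
  act : forall x y : vertex Q, arr x y -> 'Hom(space x, space y) }.

Section Modules.
Variables (K : fieldType) (Q : quiver).

Fixpoint on_path (M : qmod K Q) (x y : vertex Q) (p : qpath x y) :
    'Hom(M x, M y) :=
  match p with
  | pnil x => \1%VF
  | pcons _ _ _ a p' => (on_path M p' \o act M a)%VF
  end.

Definition on_kpath (M : qmod K Q) (x y : vertex Q) (u : kpath K x y) :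
    'Hom(M x, M y) :=
  \sum_(p <- msupp u) u@_p *: on_path M p.

(** [M] is a module over the quotient of the path category by [I]. *)
Definition is_module (I : ideal K Q) (M : qmod K Q) : Prop :=
  forall x y (u : kpath K x y), I x y u -> on_kpath M u = 0.

Definition qmod_iso (M N : qmod K Q) : Prop :=
  exists2 f : forall x, 'Hom(M x, N x),
    forall x, bijective (f x)
    & forall x y (a : arr x y), (f y \o act M a = act N a \o f x)%VF.

(** Isomorphism in the category of modules over the quotient by [I], a full
    subcategory of that of modules over the path category. *)
Definition quot_iso (I : ideal K Q) (M N : qmod K Q) : Prop :=
  [/\ is_module I M, is_module I N & qmod_iso M N].

Definition qtensor (M N : qmod K Q) : qmod K Q :=
  QMod (fun x y (a : arr x y) => tensor_lfun (act M a) (act N a)).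

Definition qadd (M N : qmod K Q) : qmod K Q :=
  @QMod K Q (fun x => (M x * N x)%type)
    (fun x y (a : arr x y) => pair_lfun (act M a) (act N a)).

Definition qsum (I : finType) (M : I -> qmod K Q) : qmod K Q :=
  @QMod K Q (fun x => dsum (fun i => M i x))
    (fun x y (a : arr x y) => dsum_diag (fun i => act (M i) a)).

Definition qcopies (d : nat) (M : qmod K Q) : qmod K Q :=
  qsum (fun _ : 'I_d => M).
End Modules.

Definition is_wrapping (P Q : quiver) (F : qhom P Q) : Prop :=
  forall x y : vertex P, injective (@on_arr P Q F x y).

Definition is_strict (P Q : quiver) (F : qhom P Q) : Prop :=
  forall a b : arrow P, a <> b -> on_arrow F a = on_arrow F b ->
    qtail a <> qtail b /\ qhead a <> qhead b.

Record qshape (Q : quiver) := Shape {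
  sdom : quiver;
  sfun :> qhom sdom Q;
  shape_wrapping : is_wrapping sfun;
  shape_strict : is_strict sfun }.

Definition shape_iso (Q : quiver) (F1 F2 : qshape Q) : Prop :=
  exists2 s : qhom (sdom F1) (sdom F2), qhom_iso s & qhom_eq F1 (qhom_comp F2 s).

Definition trivial_aut (Q : quiver) (F : qshape Q) : Prop :=
  forall s : qhom (sdom F) (sdom F), qhom_iso s -> qhom_eq F (qhom_comp F s) ->
    s =1 id /\ on_arrow s =1 id.

Definition compatible (K : fieldType) (P Q : quiver) (F : qhom P Q)
    (I : ideal K Q) : Prop :=
  forall x y (u : kpath K x y), I x y u ->
    exists (r : seq (qpath x y)) (c : qpath x y -> K),
      (forall p, p \in r -> ~ in_path_map F p) /\ u = \sum_(p <- r) c p *: << p >>.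

Section PushDown.
Variables (K : fieldType) (P Q : quiver) (F : qhom P Q) (M : qmod K P).

Definition fibre (x' : vertex Q) : finType := {x : vertex P | F x == x'}.

(** For a wrapping there is at most one arrow to pick. *)
Definition push_comp (x' y' : vertex Q) (a' : arr x' y')
    (x : fibre x') (y : fibre y') : 'Hom(M (val x), M (val y)) :=
  if [pick a : arr (val x) (val y) | on_arrow F (val a) == val a'] is Some a
  then act M a else 0.

Definition push : qmod K Q :=
  @QMod K Q (fun x' => dsum (fun x : fibre x' => M (val x)))
    (fun x' y' (a' : arr x' y') => dsum_lfun (push_comp a')).
End PushDown.

Definition joins (Q : quiver) (a : arrow Q) (x y : vertex Q) : Prop :=
  (qtail a = x /\ qhead a = y) \/ (qtail a = y /\ qhead a = x).

(** The underlying graph is the Dynkin diagram A_(n+1) for some [n]. *)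
Definition is_linear (Q : quiver) : Prop :=
  exists (n : nat) (v : 'I_n.+1 -> vertex Q) (a : 'I_n -> arrow Q),
    [/\ bijective v, bijective a &
        forall i, joins (a i) (v (widen_ord (leqnSn n) i)) (v (lift ord0 i))].

(** The underlying graph is a cycle with [n + 1] vertices and edges: a loop for
    [n = 0], a double edge for [n = 1]. *)
Definition is_cyclic (Q : quiver) : Prop :=
  exists (n : nat) (v : 'I_n.+1 -> vertex Q) (a : 'I_n.+1 -> arrow Q),
    [/\ bijective v, bijective a & forall i, joins (a i) (v i) (v (ordS i))].

Definition linear_shape (Q : quiver) (F : qshape Q) : Prop := is_linear (sdom F).

Definition cyclic_shape (Q : quiver) (G : qshape Q) : Prop :=
  is_cyclic (sdom G) /\ trivial_aut G.

Section StringsBands.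
Variables (K : fieldType) (Q : quiver).

Definition chi (L : quiver) : qmod K L :=
  @QMod K L (fun=> K^o) (fun _ _ _ => \1%VF).

Definition string_mod (F : qshape Q) : qmod K Q := push F (chi (sdom F)).

Definition jordan (l : K) (s : nat) : 'M[K]_s :=
  \matrix_(i, j) (if i == j then l else if val j == (val i).+1 then 1 else 0).

Definition cyclic_mod (Z : quiver) (l : K) (s : nat) (g : arrow Z) : qmod K Z :=
  @QMod K Z (fun=> 'cV[K]_s)
    (fun _ _ a => if val a == g then linfun (mulmx (jordan l s)) else \1%VF).

Definition band_mod (G : qshape Q) (l : K) (s : nat) (g : arrow (sdom G)) :
    qmod K Q :=
  push G (cyclic_mod l s g).
End StringsBands.

(** [l] lists the sizes of the blocks of the Jordan normal form of the Kronecker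
    product of [jordan a s] and [jordan b t], in non-increasing order. *)
Definition jordan_sizes (K : fieldType) (a b : K) (s t : nat) (l : seq nat) :
    Prop :=
  [/\ sorted geq l, all (ltn 0) l &
      exists X : 'M[K]_(s * t, \sum_(k < size l) nth 0 l k),
        [/\ row_free X, row_full X &
            (jordan a s *t jordan b t) *m X =
            X *m \mxdiag_(k < size l) jordan (a * b) (nth 0%N l k)]].

Section FibreProduct.
Variables (Q : quiver) (F F' : qshape Q).
Local Notation P := (sdom F).
Local Notation P' := (sdom F').

Definition fp_vertex : finType :=
  {x : vertex P * vertex P' | F x.1 == F' x.2}.
Definition fp_arrow : finType :=
  {a : arrow P * arrow P' | on_arrow F a.1 == on_arrow F' a.2}.

Fact fp_tail_subproof (a : fp_arrow) :
  F (qtail (val a).1) == F' (qtail (val a).2).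
Proof. by rewrite -!qhom_tail (eqP (valP a)). Qed.
Fact fp_head_subproof (a : fp_arrow) :
  F (qhead (val a).1) == F' (qhead (val a).2).
Proof. by rewrite -!qhom_head (eqP (valP a)). Qed.

Definition fibre_product : quiver :=
  @Quiver fp_vertex fp_arrow
    (fun a => Sub (qtail (val a).1, qtail (val a).2) (fp_tail_subproof a))
    (fun a => Sub (qhead (val a).1, qhead (val a).2) (fp_head_subproof a)).

Definition fp_proj1 : qhom fibre_product P :=
  @QHom fibre_product P (fun x => (val x).1) (fun a => (val a).1)
    (fun a => erefl) (fun a => erefl).
End FibreProduct.

Section Components.
Variable P : quiver.

Section Full.
Variable C : {set vertex P}.

Definition full_vertex : finType := {x : vertex P | x \in C}.
Definition full_arrow : finType :=
  {a : arrow P | (qtail a \in C) && (qhead a \in C)}.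

Definition full_subquiver : quiver :=
  @Quiver full_vertex full_arrow
    (fun a => Sub (qtail (val a)) (proj1 (andP (valP a))))
    (fun a => Sub (qhead (val a)) (proj2 (andP (valP a)))).

Definition full_incl : qhom full_subquiver P :=
  @QHom full_subquiver P val val (fun a => erefl) (fun a => erefl).
End Full.

Definition adjacent : rel (vertex P) := fun x y =>
  [exists a : arrow P, ((qtail a == x) && (qhead a == y))
                    || ((qtail a == y) && (qhead a == x))].

Definition components : {set {set vertex P}} :=
  [set [set y | connect adjacent x y] | x : vertex P].
End Components.

Section LinearFamily.
Variables (Q : quiver) (F F' : qshape Q).
Local Notation FP := (fibre_product F F').

Definition fp_fun (C : {set vertex FP}) : qhom (full_subquiver C) Q :=
  qhom_comp F (qhom_comp (fp_proj1 F F') (full_incl C)).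

Fact fp_fun_strict C : is_strict (fp_fun C).
Proof.
move=> a b ab /= Fab.
have {}ab : (val (val a)).1 != (val (val b)).1
         \/ (val (val a)).2 != (val (val b)).2.
  apply/orP; rewrite -negb_and; apply/andP => -[/eqP e1 /eqP e2].
  by apply: ab; do 2!apply: val_inj; apply/eqP; rewrite -pair_eqE /= e1 e2 !eqxx.
case: ab => /eqP ab.
  have [ht hh] := shape_strict ab Fab.
  by split=> [/(congr1 (fun x => (val (val x)).1))|/(congr1 (fun x => (val (val x)).1))].
have Fab' : on_arrow F' (val (val a)).2 = on_arrow F' (val (val b)).2.
  by rewrite -(eqP (valP (val a))) -(eqP (valP (val b))).
have [ht hh] := shape_strict ab Fab'.
by split=> [/(congr1 (fun x => (val (val x)).2))|/(congr1 (fun x => (val (val x)).2))].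
Qed.

Lemma strict_wrapping (P : quiver) (G : qhom P Q) : is_strict G -> is_wrapping G.
Proof.
move=> sG x y a b /(congr1 val) /= Gab; apply: val_inj.
apply: contrapT => ab; have [+ _] := sG _ _ ab Gab; apply.
by case/andP: (valP a) (valP b) => /eqP-> _ /andP[/eqP-> _].
Qed.

Definition fp_shape (C : {set vertex FP}) : qshape Q :=
  Shape (strict_wrapping (@fp_fun_strict C)) (@fp_fun_strict C).

Definition linear_components : finType :=
  {C : {set vertex FP} | (C \in components FP) && `[< linear_shape (fp_shape C) >]}.
End LinearFamily.

(* Main.v *)
(** Both factors are push-downs of modules given by invertible matrices on the arrows of
    a line or a cycle, so they have bases indexed by pairs (vertex, index).
    In the tensor product, the pairs of basis vectors lying over a common vertex of [Q]
    are indexed by the vertices of the fibre product, and the product of the two actions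
    is the push-down of the Kronecker products of the matrices.  It splits along the
    connected components of the fibre product.

    By strictness, orienting a line or a cycle coherently orients the fibre product so
    that each vertex is the start of at most one arrow and the end of at most one.  Hence
    a component is either a line or has an arrow starting at every vertex.  The latter is
    impossible over a line, and over two cycles it makes one read the same cyclic word
    round both; as the cycles have no symmetries, they have the same length and are
    isomorphic over [Q], and if they are equal then the component is the diagonal.

    On a line invertible matrices can be gauged away, which leaves copies of a string.  On
    the diagonal one finds the product of the two Jordan blocks, brought to Jordan form
    by the matrix which [jordan_sizes] provides. *)
From HB Require Import structures.
Require Import Defs.
From mathcomp Require Import all_boot all_order all_algebra.
From mathcomp Require Import finmap.
From mathcomp.real_closed Require Import mxtens.
From mathcomp.multinomials Require Import monalg.
From mathcomp.classical Require Import boolp.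

Set Implicit Arguments.
Unset Strict Implicit.
Unset Printing Implicit Defensive.
Import GRing.Theory.
Local Open Scope ring_scope.

(** * Linear maps on direct sums and tensor products *)

Section LinearFunctions.
Variables (K : fieldType) (V W : vectType K) (f : V -> W).
Hypothesis lin_f : linear f.

Let fL : {linear V -> W} := HB.pack f (GRing.isLinear.Build _ _ _ _ f lin_f).

Definition lfun_of : 'Hom(V, W) := linfun fL.

Lemma lfun_ofE v : lfun_of v = f v.
Proof. by rewrite lfunE. Qed.
End LinearFunctions.

Lemma dsum0 (K : fieldType) (I : finType) (V : I -> vectType K) i : (0 : dsum V) i = 0.
Proof. by rewrite -[0 : dsum V](scale0r (0 : dsum V)) dsumZ scale0r. Qed.

Lemma dsum_sum (K : fieldType) (I J : finType) (V : I -> vectType K)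
    (P : pred J) (f : J -> dsum V) i :
  (\sum_(j | P j) f j) i = \sum_(j | P j) f j i.
Proof.
by elim/big_rec2: _ => [|j u v _ <-]; rewrite ?dsum0 ?dsumD.
Qed.

Lemma tens0 (K : fieldType) (U V : vectType K) (v : V) : tens (0 : U) v = 0.
Proof. by rewrite -[tens 0 v](lfun_ofE (tens_linearl v)) linear0. Qed.

(** Stated as a [sig] and obtained by choice, because these functionals become the coordinates of a
    [presentation], which is data. *)
Lemma tensor_functional (K : fieldType) (U V : vectType K)
    (f : 'Hom(U, K^o)) (g : 'Hom(V, K^o)) :
  {h : 'Hom(tensor U V, K^o) | forall u v, h (tens u v) = f u * g v}.
Proof.
apply: cid.
have [v|u|h [hE _]] := @tensor_universal K U V K^o (fun u v => f u * g v).
- by move=> a u u' /=; rewrite linearP mulrDl -mulrA.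
- by move=> a v v' /=; rewrite linearP mulrDr mulrCA.
by exists h.
Qed.

Lemma tensor_lfun_ext (K : fieldType) (U V W : vectType K)
    (h1 h2 : 'Hom(tensor U V, W)) :
  (forall u v, h1 (tens u v) = h2 (tens u v)) -> h1 = h2.
Proof.
move=> h12.
have [v|u|h [_ hU]] := @tensor_universal K U V W (fun u v => h2 (tens u v)).
- by move=> a u u'; rewrite tens_linearl linearP.
- by move=> a v v'; rewrite tens_linearr linearP.
by rewrite -(hU h1) // -(hU h2).
Qed.

(** A module with a homogeneous basis: [pos] is the vertex of a basis element,
    [coef a b' b] is the matrix of the arrow [a], and [pvec x b], [pcoord x b] are
    junk unless [pos b = x]. *)
Record presentation (K : fieldType) (Q : quiver) (M : qmod K Q) (B : finType)
    (pos : B -> vertex Q) (coef : arrow Q -> B -> B -> K) := Presentation {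
  pvec : forall x, B -> M x;
  pcoord : forall x, B -> 'Hom(M x, K^o);
  pcoord_vec : forall x b b', pos b = x -> pos b' = x ->
    pcoord x b (pvec x b') = (b == b')%:R;
  pvec_sum : forall x (v : M x),
    v = \sum_(b | pos b == x) pcoord x b v *: pvec x b;
  pcoord_act : forall x y (a : arr x y) b b', pos b = x -> pos b' = y ->
    pcoord y b' (act M a (pvec x b)) = coef (val a) b' b }.

(** * Homogeneous bases under base change, tensor product, direct sum and push-down *)

Section Presentations.
Variables (K : fieldType) (Q : quiver).

Section Coordinates.
Variables (M : qmod K Q) (B : finType) (pos : B -> vertex Q).
Variable coef : arrow Q -> B -> B -> K.

Lemma pact (p : presentation M pos coef) x y (a : arr x y) b : pos b = x ->
  act M a (pvec p x b) = \sum_(b' | pos b' == y) coef (val a) b' b *: pvec p y b'.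
Proof.
move=> bx; rewrite [LHS](pvec_sum p); apply: eq_bigr => b' /eqP b'y.
by rewrite pcoord_act.
Qed.

Lemma pcoord_sum (p : presentation M pos coef) x b (c : B -> K) : pos b = x ->
  pcoord p x b (\sum_(b' | pos b' == x) c b' *: pvec p x b') = c b.
Proof.
move=> bx; rewrite linear_sum (bigD1 b) ?bx //= big1 ?addr0 => [|b' /andP[/eqP b'x b'b]].
  by rewrite linearZ /= pcoord_vec // eqxx [LHS]mulr1.
by rewrite linearZ /= pcoord_vec // eq_sym (negPf b'b) [LHS]mulr0.
Qed.

End Coordinates.

Section Change.
Variables (M : qmod K Q) (B : finType) (pos : B -> vertex Q).
Variable coef : arrow Q -> B -> B -> K.

(** Reduces the isomorphisms below to comparing structure constants: the map matching the two bases
    commutes with the arrows, since both actions have the matrix [coef]. *)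
Lemma presentation_iso (N : qmod K Q) :
  presentation M pos coef -> presentation N pos coef -> qmod_iso M N.
Proof.
move=> p q.
pose f x (v : M x) : N x := \sum_(b | pos b == x) pcoord p x b v *: pvec q x b.
pose g x (v : N x) : M x := \sum_(b | pos b == x) pcoord q x b v *: pvec p x b.
have lf x : linear (@f x).
  move=> c u v; rewrite /f scaler_sumr -big_split; apply: eq_bigr => b _.
  by rewrite linearP /= scalerDl scalerA.
exists (fun x => lfun_of (lf x)) => [x|x y a].
  exists (@g x) => v; rewrite lfun_ofE /g /f.
    rewrite [RHS](pvec_sum p); apply: eq_bigr => b /eqP bx.
    by rewrite pcoord_sum.
  rewrite [RHS](pvec_sum q); apply: eq_bigr => b /eqP bx.
  by rewrite pcoord_sum.
apply/lfunP => v; rewrite !comp_lfunE !lfun_ofE [v in LHS](pvec_sum p) /f.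
rewrite !linear_sum /= [RHS](eq_bigr (fun b => \sum_(b' | pos b' == y)
   pcoord p x b v *: (coef (val a) b' b *: pvec q y b'))); last first.
  by move=> b /eqP bx; rewrite linearZ /= pact // scaler_sumr.
rewrite exchange_big; apply: eq_bigr => b' /eqP b'y.
rewrite linear_sum scaler_suml; apply: eq_bigr => b /eqP bx.
by rewrite !linearZ /= pcoord_act // scalerA mulrC.
Qed.

(** The column [b'] of [T] is a new basis vector in old coordinates, and [U] is the inverse of [T].
    Only entries between basis elements at the same vertex occur in the hypotheses. *)
Lemma presentation_change (p : presentation M pos coef) (B' : finType)
    (pos' : B' -> vertex Q) (coef' : arrow Q -> B' -> B' -> K)
    (T : B -> B' -> K) (U : B' -> B -> K) :
  (forall b' c', pos' b' = pos' c' ->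
     \sum_(b | pos b == pos' b') U b' b * T b c' = (b' == c')%:R) ->
  (forall b c, pos b = pos c ->
     \sum_(b' | pos' b' == pos b) T b b' * U b' c = (b == c)%:R) ->
  (forall a b b', pos b = qhead a -> pos' b' = qtail a ->
     \sum_(c | pos c == qtail a) coef a b c * T c b' =
     \sum_(c' | pos' c' == qhead a) T b c' * coef' a c' b') ->
  presentation M pos' coef'.
Proof.
move=> UT TU CT.
have lk x b' : linear (fun v : M x =>
    \sum_(b | pos b == x) U b' b * pcoord p x b v : K^o).
  move=> k u v; rewrite scaler_sumr -big_split; apply: eq_bigr => b _.
  by rewrite linearP /= mulrDr mulrCA.
pose e x b' := \sum_(b | pos b == x) T b b' *: pvec p x b.
have ke x b b' : pos b = x -> pcoord p x b (e x b') = T b b'.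
  exact: pcoord_sum.
have {}TU x b c : pos b = x -> pos c = x ->
    \sum_(b' | pos' b' == x) T b b' * U b' c = (b == c)%:R.
  by move=> <- cb; apply: TU.
have {}UT x b' c' : pos' b' = x -> pos' c' = x ->
    \sum_(b | pos b == x) U b' b * T b c' = (b' == c')%:R.
  by move=> <- cb; apply: UT.
have eU x b : pos b = x -> pvec p x b = \sum_(b' | pos' b' == x) U b' b *: e x b'.
  move=> bx; rewrite (eq_bigr (fun b' => \sum_(c | pos c == x)
     (T c b' * U b' b) *: pvec p x c)); last first.
    move=> b' _; rewrite scaler_sumr; apply: eq_bigr => c _.
    by rewrite scalerA mulrC.
  rewrite exchange_big (bigD1 b) ?bx //= -scaler_suml TU // eqxx scale1r.
  rewrite big1 ?addr0 // => c /andP[/eqP cx cb].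
  by rewrite -scaler_suml TU // (negPf cb) scale0r.
exists e (fun x b' => lfun_of (lk x b')).
- move=> x b' c' bx cx; rewrite lfun_ofE -(UT x) //; apply: eq_bigr => b /eqP bx'.
  by rewrite ke.
- move=> x v; rewrite [LHS](pvec_sum p).
  rewrite (eq_bigr (fun b => \sum_(b' | pos' b' == x)
    (U b' b * pcoord p x b v) *: e x b')); last first.
    move=> b /eqP bx; rewrite {1}eU // scaler_sumr; apply: eq_bigr => b' _.
    by rewrite scalerA mulrC.
  rewrite exchange_big; apply: eq_bigr => b' _.
  by rewrite lfun_ofE -scaler_suml.
move=> x y a b' c' b'x c'y; rewrite lfun_ofE.
case/andP: (valP a) => /eqP ax /eqP ay.
(* The new matrix is [U coef T], which [CT] turns into [U T coef']; by [UT] only the term [d' = c']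
   survives. *)
transitivity (\sum_(b | pos b == y) U c' b *
   (\sum_(d' | pos' d' == y) T b d' * coef' (val a) d' b')).
  apply: eq_bigr => b /eqP bx; congr (_ * _).
  have := CT (val a) b b'; rewrite ax ay => <- //.
  rewrite linear_sum linear_sum; apply: eq_bigr => c /eqP cx.
  by rewrite !linearZ /= pcoord_act // [LHS]mulrC.
under eq_bigr do rewrite mulr_sumr.
rewrite exchange_big (bigD1 c') ?c'y //= [X in _ + X]big1 ?addr0.
  under eq_bigr do rewrite mulrA.
  by rewrite -mulr_suml UT // eqxx mul1r.
move=> d' /andP[/eqP d'y d'c].
under eq_bigr do rewrite mulrA.
by rewrite -mulr_suml UT // eq_sym (negPf d'c) mul0r.
Qed.

Lemma presentation_relabel (p : presentation M pos coef) (B' : finType)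
    (pos' : B' -> vertex Q) (coef' : arrow Q -> B' -> B' -> K) (h : B' -> B) :
  bijective h -> (forall b, pos' b = pos (h b)) ->
  (forall a b b', pos' b = qtail a -> pos' b' = qhead a ->
     coef' a b' b = coef a (h b') (h b)) ->
  presentation M pos' coef'.
Proof.
move=> hbij posh coefh; have hinj := bij_inj hbij.
exists (fun x b => pvec p x (h b)) (fun x b => pcoord p x (h b)).
- by move=> x b b' bx b'x; rewrite pcoord_vec -?posh ?(inj_eq hinj).
- move=> x v; rewrite [LHS](pvec_sum p) (reindex h) /=; last exact: onW_bij.
  by apply: eq_bigl => b; rewrite posh.
move=> x y a b b' bx b'y; rewrite pcoord_act -?posh // coefh //.
  by rewrite bx; case/andP: (valP a) => /eqP.
by rewrite b'y; case/andP: (valP a) => _ /eqP.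
Qed.
End Change.

Section Tensor.
Variables (M N : qmod K Q) (B B' : finType).
Variables (pos : B -> vertex Q) (pos' : B' -> vertex Q).
Variables (coef : arrow Q -> B -> B -> K) (coef' : arrow Q -> B' -> B' -> K).

Definition pos_pair : finType := {c : B * B' | pos c.1 == pos' c.2}.

Lemma presentation_tensor :
  presentation M pos coef -> presentation N pos' coef' ->
  presentation (qtensor M N)
    (fun c : pos_pair => pos (val c).1)
    (fun a c d => coef a (val c).1 (val d).1 * coef' a (val c).2 (val d).2).
Proof.
move=> p q.
exists (fun x (c : pos_pair) => tens (pvec p x (val c).1) (pvec q x (val c).2))
  (fun x (c : pos_pair) => sval (tensor_functional (pcoord p x (val c).1) (pcoord q x (val c).2))).
- move=> x c d cx dx; case: tensor_functional => h /= ->.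
  rewrite !pcoord_vec //; [|by rewrite -(eqP (valP c))|by rewrite -(eqP (valP d))].
  by rewrite -natrM mulnb -val_eqE /= -pair_eqE.
- move=> x v; have lr : linear (fun v : tensor (M x) (N x) =>
      \sum_(c : pos_pair | pos (val c).1 == x)
     sval (tensor_functional (pcoord p x (val c).1) (pcoord q x (val c).2)) v *:
        tens (pvec p x (val c).1) (pvec q x (val c).2)).
    move=> k u w; rewrite scaler_sumr -big_split; apply: eq_bigr => b _.
    by rewrite linearP /= scalerDl scalerA.
  (* Both sides are linear in [v], so it is enough to expand pure tensors. *)
  rewrite -[RHS](lfun_ofE lr) -[LHS]id_lfunE; congr (fun_of_lfun _ _).
  apply: tensor_lfun_ext => {v} u v; rewrite id_lfunE lfun_ofE.
  transitivity (\sum_(b | pos b == x) \sum_(b' | pos' b' == x)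
     (pcoord p x b u * pcoord q x b' v) *: tens (pvec p x b) (pvec q x b')).
    rewrite -[LHS](lfun_ofE (tens_linearl v)) [u in LHS](pvec_sum p) linear_sum.
    apply: eq_bigr => b _; rewrite linearZ /= lfun_ofE.
    rewrite -[tens _ _](lfun_ofE (tens_linearr _)) [v in LHS](pvec_sum q).
    rewrite linear_sum scaler_sumr.
    by apply: eq_bigr => b' _; rewrite linearZ /= lfun_ofE scalerA.
  rewrite pair_big_dep /=.
  rewrite (reindex_omap (val : pos_pair -> _) insub) /=.
    apply: eq_big => [c|c /andP[cx _]].
      rewrite valK eqxx andbT -(eqP (valP c)) andbb //.
    by case: tensor_functional => h /= ->.
  by move=> c /andP[/eqP c1 /eqP c2]; rewrite insubT //= c1 c2.
move=> x y a c d cx dy; case: tensor_functional => h /= hE.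
rewrite tensor_lfunE hE !pcoord_act //; first by rewrite -(eqP (valP c)).
by rewrite -(eqP (valP d)).
Qed.
End Tensor.

Lemma presentation_add (M N : qmod K Q) (B B' : finType)
    (pos : B -> vertex Q) (pos' : B' -> vertex Q)
    (coef : arrow Q -> B -> B -> K) (coef' : arrow Q -> B' -> B' -> K) :
  presentation M pos coef -> presentation N pos' coef' ->
  presentation (qadd M N)
    (fun c : B + B' => match c with inl b => pos b | inr b => pos' b end)
    (fun a c d => match c, d with
       inl c, inl d => coef a c d | inr c, inr d => coef' a c d | _, _ => 0 end).
Proof.
move=> p q.
have l1 x b : linear (fun v : qadd M N x => pcoord p x b v.1).
  by move=> k u v; rewrite linearP.
have l2 x b : linear (fun v : qadd M N x => pcoord q x b v.2).
  by move=> k u v; rewrite linearP.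
exists (fun x c => match c with
    inl b => (pvec p x b, 0) | inr b => (0, pvec q x b) end)
  (fun x c => match c with
    inl b => lfun_of (l1 x b) | inr b => lfun_of (l2 x b) end).
- move=> x [b|b] [b'|b'] bx b'x; rewrite lfun_ofE /= ?linear0 //; exact: pcoord_vec.
- move=> x [u v]; rewrite big_sumType /=.
  rewrite (eq_bigr (fun b => (pcoord p x b u *: pvec p x b, 0))); last first.
    by move=> b _; rewrite lfun_ofE; congr pair; rewrite /= scaler0.
  rewrite (eq_bigr (fun b => (0, pcoord q x b v *: pvec q x b))); last first.
    by move=> b _; rewrite lfun_ofE; congr pair; rewrite /= scaler0.
  have -> (I : finType) (P : pred I) (F : I -> M x) :
      \sum_(i | P i) (F i, 0 : N x) = (\sum_(i | P i) F i, 0).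
    by elim/big_rec2: _ => // i u1 u2 _ ->; congr pair; rewrite /= addr0.
  have -> (I : finType) (P : pred I) (F : I -> N x) :
      \sum_(i | P i) (0 : M x, F i) = (0, \sum_(i | P i) F i).
    by elim/big_rec2: _ => // i u1 u2 _ ->; congr pair; rewrite /= addr0.
  by rewrite -!pvec_sum; congr pair; rewrite /= ?addr0 ?add0r.
by move=> x y a [b|b] [b'|b'] bx b'x; rewrite lfun_ofE pair_lfunE /= ?linear0 //;
  apply: pcoord_act.
Qed.

Lemma presentation_sum (I : finType) (M : I -> qmod K Q) (B : I -> finType)
    (pos : forall i, B i -> vertex Q)
    (coef : forall i, arrow Q -> B i -> B i -> K) :
  (forall i, presentation (M i) (@pos i) (coef i)) ->
  presentation (qsum M)
    (fun c : {i : I & B i} => pos _ (tagged c))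
    (fun a c d => untag 0 (coef (tag c) a (tagged c)) d).
Proof.
move=> p.
have lk x (c : {i : I & B i}) : linear (fun v : qsum M x =>
    pcoord (p (tag c)) x (tagged c) (v (tag c))).
  by move=> k u v; rewrite dsumD dsumZ linearP.
have untag_eq (i : I) (b : B i) (R : Type) (z : R) (f : B i -> R) :
    untag z f (Tagged B b) = f b.
  by rewrite (untagE _ _ (erefl : tag (Tagged B b) = i)).
(* The default [0] of [untag] is the component of a basis vector in the summands it does not belong
   to. *)
exists (fun x c => mk_dsum (fun j => untag 0 (pvec (p j) x) c))
  (fun x c => lfun_of (lk x c)).
- move=> x [i b] [j c] /= bx cx; rewrite lfun_ofE mk_dsumE.
  have [ij|ij] := eqVneq i j.
    case: _ / ij c cx => c cx.
    by rewrite untag_eq pcoord_vec // eq_Tagged.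
  rewrite untag_dflt 1?eq_sym // linear0; case: eqP => // /(congr1 tag) /= e.
  by rewrite e eqxx in ij.
- move=> x v; apply/dsumP => i.
  rewrite dsum_sum.
  pose G j (b : B j) : M i x :=
    pcoord (p j) x b (v j) *: untag 0 (pvec (p i) x) (Tagged B b).
  rewrite (eq_bigr (fun c => G (tag c) (tagged c))) => [|[j b] _]; last first.
    by rewrite dsumZ mk_dsumE lfun_ofE.
  rewrite -(sig_big_dep predT (fun j b => pos j b == x) G) (bigD1 i) //=.
  rewrite [X in _ + X]big1 ?addr0 => [|j ji]; last first.
    by rewrite big1 // => b _; rewrite /G untag_dflt ?scaler0.
  by rewrite [LHS](pvec_sum (p i)); apply: eq_bigr => b _; rewrite /G untag_eq.
move=> x y a [i b] [j c] /= bx cy; rewrite lfun_ofE dsum_diagE mk_dsumE /=.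
have [ij|ij] := eqVneq i j.
  case: _ / ij c cy => c cy.
  by rewrite !untag_eq pcoord_act.
by rewrite !untag_dflt ?linear0.
Qed.
End Presentations.

(** The basis stays the same and only its position is composed with [F]. As [F] is a wrapping, the
    sum has at most one term, the arrow picked by [push_comp]. *)
Lemma presentation_push (K : fieldType) (P Q : quiver) (F : qhom P Q)
    (M : qmod K P) (B : finType) (pos : B -> vertex P)
    (coef : arrow P -> B -> B -> K) :
  is_wrapping F -> presentation M pos coef ->
  presentation (push F M) (fun b => F (pos b)) (fun a' b' b =>
    \sum_(a | [&& qtail a == pos b, qhead a == pos b' & on_arrow F a == a'])
       coef a b' b).
Proof.
move=> wF p.
(* The sum over [z] has a single term when [pos b] lies over [x]; it reads off the component at
   [pos b] without transport along an equality. *)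
have lk x (b : B) : linear (fun v : push F M x => \sum_(z : fibre F x | val z == pos b)
    pcoord p (val z) b (v z) : K^o).
  move=> k u v; rewrite scaler_sumr -big_split; apply: eq_bigr => z _.
  by rewrite dsumD dsumZ linearP.
have lkE x b v (z : fibre F x) : val z = pos b ->
    lfun_of (lk x b) v = pcoord p (val z) b (v z).
  move=> zb; rewrite lfun_ofE (big_pred1 z) // => z'.
  by rewrite /= -zb val_eqE.
exists (fun x b => mk_dsum (fun z : fibre F x =>
    if pos b == val z then pvec p (val z) b else 0)) (fun x b => lfun_of (lk x b)).
- move=> x b b' /eqP bx /eqP b'x; pose z : fibre F x := Sub (pos b) bx.
  rewrite (@lkE x b _ z) // mk_dsumE /=; case: eqP => [bb'|bb'].
    by rewrite pcoord_vec.
  by rewrite linear0; case: eqP => // e; case: bb'; rewrite e.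
- move=> x v; apply/dsumP => z.
  rewrite dsum_sum [LHS](pvec_sum p) big_mkcond [RHS]big_mkcond.
  apply: eq_bigr => b _; rewrite dsumZ mk_dsumE; case: eqP => bz; last first.
    by rewrite scaler0 if_same.
  by rewrite (@lkE x b _ z) // ifT // bz (valP z).
move=> x y a b b' /eqP bx /eqP b'y.
pose z : fibre F x := Sub (pos b) bx; pose z' : fibre F y := Sub (pos b') b'y.
rewrite (@lkE y b' _ z') // dsum_lfunE (bigD1 z) //= big1 ?addr0; last first.
  move=> w wz; rewrite mk_dsumE ifN ?linear0 //.
  by apply: contra wz => /eqP e; apply/eqP/val_inj.
rewrite mk_dsumE eqxx /push_comp; case: pickP => [c /= /eqP ca|noc].
  rewrite pcoord_act // (big_pred1 (val c)) // => c' /=.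
  have /andP[/eqP ct /eqP ch] := valP c.
  apply/and3P/eqP => [[c't c'h /eqP c'a]|->]; last first.
    by rewrite ct ch ca !eqxx.
  have c'P : (qtail c' == pos b) && (qhead c' == pos b') by rewrite c't.
  pose d : arr (pos b) (pos b') := Sub c' c'P.
  suff -> : c' = val d by congr val; apply: wF; apply: val_inj; rewrite /= c'a.
  by [].
rewrite lfunE linear0 big_pred0 // => c; apply/negP => /and3P[ct ch /eqP ca].
have cP : (qtail c == pos b) && (qhead c == pos b') by rewrite ct.
by have /negP[] := noc (Sub c cP : arr (pos b) (pos b')); apply/eqP.
Qed.

Lemma sum_pair_fst (V : nmodType) (I J : finType) (A : pred I) (f : I * J -> V) :
  \sum_(c | A c.1) f c = \sum_(x | A x) \sum_j f (x, j).
Proof. by rewrite pair_big_dep; apply: eq_big => [c|[x j] _] //; rewrite andbT. Qed.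

Lemma sum_pair_at (V : nmodType) (I J : finType) (A : pred I) (z : I)
    (f : I * J -> V) :
  A z -> (forall c, c.1 != z -> f c = 0) ->
  \sum_(c | A c.1) f c = \sum_j f (z, j).
Proof.
move=> Az f0; rewrite sum_pair_fst (bigD1 z) //= [X in _ + X]big1 ?addr0 //.
by move=> x /andP[_ xz]; rewrite big1 // => j _; apply: f0.
Qed.

(** * Push-downs of modules given by a matrix on each arrow *)

Section Twisted.
Variable K : fieldType.

Definition twist_coef (P Q : quiver) (F : qhom P Q) (d : nat)
    (D : arrow P -> 'M[K]_d) (a' : arrow Q) (c' c : vertex P * 'I_d) : K :=
  \sum_(a | [&& qtail a == c.1, qhead a == c'.1 & on_arrow F a == a']) D a c'.2 c.2.

(** [M] is the push-down along [F] of the module with spaces [K^d] and matrices [D]. *)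
Definition twisted (P Q : quiver) (M : qmod K Q) (F : qhom P Q) (d : nat)
    (D : arrow P -> 'M[K]_d) : Type :=
  presentation M (fun c : vertex P * 'I_d => F c.1) (twist_coef F D).

Lemma twisted_string (Q : quiver) (F : qshape Q) :
  twisted (string_mod K F) F (fun=> 1%:M : 'M_1).
Proof.
apply: (@presentation_push K (sdom F) Q F (chi K (sdom F)) _ fst
          (fun a c' c => 1%:M c'.2 c.2)); first exact: shape_wrapping.
have ord1_eq (c c' : vertex (sdom F) * 'I_1) : c.1 = c'.1 -> c == c'.
  by case: c c' => [x i] [y j] /= ->; rewrite -pair_eqE /= !ord1 !eqxx.
exists (fun _ _ => 1 : K^o) (fun _ _ => \1%VF).
- by move=> x b b' bx b'x; rewrite id_lfunE ord1_eq // bx.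
- move=> x v; rewrite (big_pred1 (x, ord0)); last first.
    by case=> y i; rewrite /= -pair_eqE /= ord1 eqxx andbT.
  by rewrite id_lfunE [RHS]mulr1.
by move=> x y a b b' _ _; rewrite !id_lfunE mxE !ord1 eqxx.
Qed.

Definition band_twist (s : nat) (a : K) (Z : quiver) (g al : arrow Z) : 'M[K]_s :=
  if al == g then jordan a s else 1%:M.

Lemma twisted_band (Q : quiver) (G : qshape Q) (a : K) (s : nat)
    (g : arrow (sdom G)) :
  twisted (band_mod a s g) G (band_twist s a g).
Proof.
apply: (@presentation_push K (sdom G) Q G (cyclic_mod a s g) _ fst
          (fun al c' c => band_twist s a g al c'.2 c.2)); first exact: shape_wrapping.
have lk (c : vertex (sdom G) * 'I_s) : linear (fun v : 'cV[K]_s => v c.2 0 : K^o).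
  by move=> k u v; rewrite !mxE.
exists (fun _ c => delta_mx c.2 0 : 'cV[K]_s) (fun _ c => lfun_of (lk c)).
- move=> x [y i] [z j] /= -> ->; rewrite lfun_ofE mxE andbT -pair_eqE /=.
  by rewrite eqxx.
- move=> x v; rewrite [RHS](eq_bigr (fun c : _ * _ => v c.2 0 *: (delta_mx c.2 0 : 'cV_s))).
    rewrite (sum_pair_fst (pred1 x)) big_pred1_eq /= [LHS]matrix_sum_delta; apply: eq_bigr => i _; by rewrite big_ord1.
  by move=> c _; rewrite lfun_ofE.
move=> x y al [z i] [w j] /= _ _; rewrite lfun_ofE /band_twist.
case: ifP => _ /=; last by rewrite id_lfunE !mxE andbT.
by rewrite lfunE /= -colE mxE.
Qed.

(** An isomorphism of modules over [P], given by the matrices [T x], carried to the push-down. The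
    sizes [d] and [d'] are kept apart because in the product of two bands on one cycle they are
    equal only by a computation of ranks. *)
Lemma twisted_gauge (P Q : quiver) (M : qmod K Q) (F : qhom P Q) (d d' : nat)
    (D : arrow P -> 'M[K]_d) (D' : arrow P -> 'M[K]_d')
    (T : vertex P -> 'M[K]_(d, d')) (U : vertex P -> 'M[K]_(d', d)) :
  (forall x, T x *m U x = 1%:M) -> (forall x, U x *m T x = 1%:M) ->
  (forall a, D a *m T (qtail a) = T (qhead a) *m D' a) ->
  twisted M F D -> twisted M F D'.
Proof.
move=> TU UT DT p.
(* The positions only record [F x], so different vertices of [P] can share a position. The matrices
   are therefore extended by zero between different vertices. *)
have delta m n (A : vertex P -> 'M[K]_(m, n)) (B : vertex P -> 'M[K]_(n, m)) :
    (forall x, A x *m B x = 1%:M) -> forall c c' : vertex P * 'I_m, F c.1 = F c'.1 ->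
  \sum_(b : vertex P * 'I_n | F b.1 == F c.1) (if c.1 == b.1 then A c.1 c.2 b.2 else 0) *
     (if b.1 == c'.1 then B b.1 b.2 c'.2 else 0) = (c == c')%:R.
  move=> AB [x i] [y j] /= Fxy.
  rewrite (@sum_pair_at _ _ _ (fun z => F z == F x) x) => [||[z k] /= zx]; last 1 first.
  - by rewrite eq_sym (negPf zx) mul0r.
  - rewrite /= eqxx -pair_eqE /=; have [_|_] := eqVneq x y; last first.
      by rewrite big1 // => k _; rewrite mulr0.
    have -> : ((i == j)%:R : K) = (A x *m B x) i j by rewrite AB mxE.
    by rewrite mxE.
  by [].
apply: (presentation_change p
  (T := fun b b' => if b.1 == b'.1 then T b.1 b.2 b'.2 else 0)
  (U := fun b b' => if b.1 == b'.1 then U b.1 b.2 b'.2 else 0)) => [c c' cc'|c c' cc'|].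
- exact: delta UT _ _ cc'.
- exact: delta TU _ _ cc'.
move=> a [y i] [x j] /= ya xa.
rewrite (@sum_pair_at _ _ _ (fun z => F z == qtail a) x) ?xa => [||[z k] /= zx];
  [|by []|by rewrite (negPf zx) mulr0].
rewrite (@sum_pair_at _ _ _ (fun z => F z == qhead a) y) ?ya => [||[z k] /= zx];
  [|by []|by rewrite eq_sym (negPf zx) mul0r].
rewrite /twist_coef /=.
under eq_bigr do rewrite eqxx mulr_suml.
under [RHS]eq_bigr do rewrite eqxx mulr_sumr.
rewrite exchange_big [RHS]exchange_big; apply: eq_bigr => al /= /and3P[/eqP al1 /eqP al2 _].
by have /matrixP/(_ i j) := DT al; rewrite !mxE al1 al2.
Qed.

(** The product of two sums [twist_coef] at the arrow [a'] of [Q] runs over pairs of arrows that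
    both map to [a'], which are the arrows of the fibre product over [a']. [mxtens_index] flattens
    the pairs of indices as in the Kronecker product. *)
Lemma twisted_tensor (Q : quiver) (M N : qmod K Q) (F F' : qshape Q) (d d' : nat)
    (D : arrow (sdom F) -> 'M[K]_d) (D' : arrow (sdom F') -> 'M[K]_d') :
  twisted M F D -> twisted N F' D' ->
  twisted (qtensor M N) (qhom_comp F (fp_proj1 F F'))
    (fun a : arrow (fibre_product F F') => D (val a).1 *t D' (val a).2).
Proof.
move=> p q.
pose B := pos_pair (fun c : vertex (sdom F) * 'I_d => F c.1)
                   (fun c : vertex (sdom F') * 'I_d' => F' c.1).
pose h (c : fp_vertex F F' * 'I_(d * d')) : B := Sub
  (((val c.1).1, (mxtens_unindex c.2).1), ((val c.1).2, (mxtens_unindex c.2).2))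
  (valP c.1).
apply: (presentation_relabel (presentation_tensor p q) (h := h)) => //.
  exists (fun c : B => (Sub ((val c).1.1, (val c).2.1) (valP c) : fp_vertex F F',
                        mxtens_index ((val c).1.2, (val c).2.2))).
    case=> [z i]; congr (_, _); first by apply: val_inj => /=; case: (val z).
    by rewrite -[RHS]mxtens_unindexK; congr mxtens_index; case: mxtens_unindex.
  by case=> [[[x i] [y j]] Fxy]; apply: val_inj; rewrite /h SubK !mxtens_indexK.
move=> a [x i] [y j] _ _; rewrite -[i]mxtens_unindexK -[j]mxtens_unindexK.
case: (mxtens_unindex i) (mxtens_unindex j) => [i1 i2] [j1 j2].
rewrite /h !SubK !mxtens_indexK /twist_coef mulr_suml.
under [RHS]eq_bigr do rewrite mulr_sumr.
rewrite pair_big_dep /=.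
rewrite [RHS](reindex_omap (val : fp_arrow F F' -> _) insub) /= => [|[al al'] /=]; last first.
  case/andP=> /and3P[_ _ /eqP ala] /and3P[_ _ /eqP al'a].
  by rewrite insubT //= ala al'a.
apply: eq_big => [al|al _]; last by rewrite tensmxE.
rewrite valK eqxx andbT -!val_eqE /= -!pair_eqE /= -(eqP (valP al)).
by do 5?[case: (_ == _) => //=]; rewrite ?andbF.
Qed.
End Twisted.

(** * Modules over the quotient *)

Section IsModule.
Variables (K : fieldType) (Q : quiver).

(** Lets several elements be expanded over a common finite set of paths, which gives the linearity
    of [on_kpath]. *)
Lemma on_kpath_supp (M : qmod K Q) x y (u : kpath K x y) (S : {fset qpath x y}) :
  (msupp u `<=` S)%fset -> on_kpath M u = \sum_(p <- S) u@_p *: on_path M p.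
Proof.
move=> uS; rewrite /on_kpath; apply: (big_fset_incl _ uS) => p _ pu.
by rewrite mcoeff_outdom // scale0r.
Qed.

Lemma on_kpathD (M : qmod K Q) x y (u v : kpath K x y) :
  on_kpath M (u + v) = on_kpath M u + on_kpath M v.
Proof.
rewrite (@on_kpath_supp M x y (u + v) (msupp u `|` msupp v)%fset); last exact: msuppD_le.
rewrite (on_kpath_supp M (fsubsetUl (msupp u) (msupp v))).
rewrite (on_kpath_supp M (fsubsetUr (msupp u) (msupp v))) -big_split /=.
by apply: eq_bigr => p _; rewrite mcoeffD scalerDl.
Qed.

Lemma on_kpathZ (M : qmod K Q) x y (c : K) (u : kpath K x y) :
  on_kpath M (c *: u) = c *: on_kpath M u.
Proof.
rewrite (@on_kpath_supp M x y (c *: u) (msupp u)); last exact: msuppZ_le.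
rewrite /on_kpath scaler_sumr.
by apply: eq_bigr => p _; rewrite mcoeffZ scalerA.
Qed.

Lemma on_kpath0 (M : qmod K Q) x y : on_kpath M (0 : kpath K x y) = 0.
Proof. by rewrite -(scale0r (0 : kpath K x y)) on_kpathZ scale0r. Qed.

Lemma on_kpath_sum (M : qmod K Q) x y (J : Type) (r : seq J) (f : J -> kpath K x y) :
  on_kpath M (\sum_(j <- r) f j) = \sum_(j <- r) on_kpath M (f j).
Proof. exact: (big_morph _ (@on_kpathD M x y) (on_kpath0 M x y)). Qed.

Lemma on_kpathU (M : qmod K Q) x y (p : qpath x y) :
  on_kpath M (<< p >> : kpath K x y) = on_path M p.
Proof.
rewrite (@on_kpath_supp M x y _ [fset p]%fset); last exact: msuppU_le.
by rewrite big_seq_fset1 mcoeffU eqxx scale1r.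
Qed.

Lemma on_path_cat (M : qmod K Q) x y z (p : qpath x y) (q : qpath y z) :
  on_path M (pcat p q) = (on_path M q \o on_path M p)%VF.
Proof.
elim: p q => [{}x|{}x x' {}y a p IH] q /=; first by rewrite comp_lfun1r.
by rewrite IH comp_lfunA.
Qed.

Lemma on_kpath_comp (M : qmod K Q) x y z (u : kpath K x y) (v : kpath K y z) :
  on_kpath M (kcomp u v) = (on_kpath M v \o on_kpath M u)%VF.
Proof.
apply/lfunP => w; rewrite comp_lfunE /kcomp on_kpath_sum [on_kpath M u]/on_kpath.
rewrite [X in on_kpath M v X]sum_lfunE linear_sum sum_lfunE /=; apply: eq_bigr => p _.
rewrite on_kpath_sum [on_kpath M v]/on_kpath !sum_lfunE; apply: eq_bigr => q _.
rewrite on_kpathZ on_kpathU on_path_cat !scale_lfunE comp_lfunE linearZ scalerA.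
by rewrite mulrC.
Qed.

(** Bundled as an ideal so that the minimality in [generates] applies to it: a module is killed by
    an ideal as soon as it is killed by its generators. *)
Definition annihilator (M : qmod K Q) : ideal K Q.
Proof.
exists (fun x y u => on_kpath M u = 0) => [x y|x y u v u0 v0|x y c u u0|x y z u v v0|x y z u v u0].
- exact: on_kpath0.
- by rewrite on_kpathD u0 v0 addr0.
- by rewrite on_kpathZ u0 scaler0.
- by rewrite on_kpath_comp v0 comp_lfun0l.
- by rewrite on_kpath_comp u0 comp_lfun0r.
Defined.

Lemma on_path_tensor (M N : qmod K Q) x y (p : qpath x y) u v :
  on_path (qtensor M N) p (tens u v) = tens (on_path M p u) (on_path N p v).
Proof.
elim: p u v => [{}x|{}x x' {}y a p IH] u v /=; first by rewrite !id_lfunE.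
by rewrite !comp_lfunE /= tensor_lfunE IH.
Qed.

(** A path acts on pure tensors by acting on both factors. Hence a path that vanishes on [M]
    vanishes on the product, and two paths that agree on [M] and on [N] agree on it; general linear
    relations would not pass to the product. *)
Lemma is_module_tensor (I : ideal K Q) (M N : qmod K Q) :
  semi_monomial I -> is_module I M -> is_module I N -> is_module I (qtensor M N).
Proof.
case=> R RE [RI IR] IM IN; apply: (IR (annihilator (qtensor M N))) => x y u Ru /=.
have [[p uE]|[p [q uE]]] := RE x y u Ru.
  have p0 : on_path M p = 0 by rewrite -on_kpathU -uE; apply/IM/RI.
  rewrite uE on_kpathU; apply: tensor_lfun_ext => v w.
  by rewrite on_path_tensor p0 !zero_lfunE tens0.
have pq (L : qmod K Q) : is_module I L -> on_path L p = on_path L q.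
  move=> IL; apply/eqP; rewrite -subr_eq0 -!on_kpathU -scaleN1r -on_kpathZ -on_kpathD.
  by rewrite scaleN1r -uE; apply/eqP/IL/RI.
rewrite uE on_kpathD -scaleN1r on_kpathZ !on_kpathU scaleN1r; apply/eqP.
rewrite subr_eq0; apply/eqP/tensor_lfun_ext => v w.
by rewrite !on_path_tensor (pq M) // (pq N).
Qed.

Lemma is_module_iso (I : ideal K Q) (M N : qmod K Q) :
  qmod_iso M N -> is_module I M -> is_module I N.
Proof.
case=> f fbij fact IM x y u Iu.
have fpath x' y' (p : qpath x' y') : (f y' \o on_path M p = on_path N p \o f x')%VF.
  elim: p => [{}x'|{}x' z {}y' a p IH] /=; first by rewrite comp_lfun1l comp_lfun1r.
  by rewrite comp_lfunA IH -comp_lfunA fact comp_lfunA.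
apply/lfunP => v; have [h _ fh] := fbij x; rewrite -[v]fh zero_lfunE.
transitivity (f y (on_kpath M u (h v))); last by rewrite IM // zero_lfunE linear0.
rewrite /on_kpath !sum_lfunE linear_sum; apply: eq_bigr => p _.
by rewrite !scale_lfunE linearZ /= -[f y _]comp_lfunE fpath comp_lfunE.
Qed.
End IsModule.

(** * Compatible push-downs satisfy the relations *)

Section PushModule.
Variables (K : fieldType) (P Q : quiver) (F : qhom P Q) (M : qmod K P).

(** Refines [in_path_map] by the endpoints of the lift, which must match when an arrow is put in
    front of it. *)
Inductive lifts : forall x y : vertex Q, qpath x y -> vertex P -> vertex P -> Prop :=
| Lifts z w (g : qpath z w) : lifts (Defs.path_map F g) z w.

Lemma lifts_in_path_map x y (p : qpath x y) z w : lifts p z w -> in_path_map F p.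
Proof. by case=> u v g; apply: InPathMap. Qed.

Lemma lifts_cons x y z (a : arr x y) (p : qpath y z) u v w (al : arr u v) :
  F u = x -> on_arrow F (val al) = val a -> lifts p v w -> lifts (pcons a p) u w.
Proof.
move=> Fu; case: _ / Fu a => a ala pl.
case: _ _ _ _ _ / pl al a ala => {v w} v w g al a ala.
have -> : a = on_arr F al by apply: val_inj; rewrite -ala.
exact: (Lifts (pcons al g)).
Qed.

Let at_ (x : vertex Q) (z : fibre F x) (v : push F M x) : push F M x :=
  mk_dsum (fun z' => if z' == z then v z' else 0).

Let at_sum x (v : push F M x) : v = \sum_z at_ z v.
Proof.
apply/dsumP => z; rewrite dsum_sum (bigD1 z) //= mk_dsumE eqxx big1 ?addr0 //.
by move=> z' z'z; rewrite mk_dsumE eq_sym (negPf z'z).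
Qed.

(** Along the path, a nonzero component of the action has to pass through vertices of [P] joined by
    lifts of the arrows, since [push_comp] is zero where no arrow lifts. *)
Lemma on_path_push_lifts x y (p : qpath x y) (z : fibre F x) (w : fibre F y)
    (v : push F M x) :
  (forall z', z' != z -> v z' = 0) -> on_path (push F M) p v w != 0 ->
  lifts p (val z) (val w).
Proof.
elim: p z w v => [{}x|{}x x' {}y a p IH] z w v v0 /=.
  rewrite id_lfunE => vw; have -> : w = z by apply: contraNeq vw => /v0->.
  by case: z {v0} => z /= /eqP Fz; case: _ / Fz v w vw => v w _; apply: (Lifts (pnil z)).
rewrite comp_lfunE [act _ a v]at_sum linear_sum dsum_sum => pw.
(* Some component of the image under the first arrow contributes to the value at [w]; the lift of
   the remaining path starts at its position [z1]. *)
have /existsP[z1 z1w] : [exists z1, on_path (push F M) p (at_ z1 (act (push F M) a v)) w != 0].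
  apply: contraNT pw => /existsPn noz; rewrite big1 // => z1 _.
  by have := noz z1; rewrite negbK => /eqP.
have pl : lifts p (val z1) (val w).
  by apply: IH z1w => z' z'z; rewrite mk_dsumE (negPf z'z).
have : push_comp M a z z1 != 0.
  apply: contraNneq z1w => c0; rewrite (_ : at_ _ _ = 0) ?linear0; last first.
    apply/dsumP => z'; rewrite mk_dsumE; case: eqP => [->|_].
      rewrite /= dsum_lfunE (bigD1 z) //= c0 zero_lfunE big1 ?addr0 => [|z2 z2z].
        by rewrite dsum0.
      by rewrite v0 // linear0.
    by rewrite dsum0.
  by rewrite dsum0.
rewrite /push_comp; case: pickP => [al /= /eqP ala _|_]; last by rewrite eqxx.
by apply: lifts_cons ala pl; apply/eqP/(valP z).
Qed.

Lemma on_path_push x y (p : qpath x y) :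
  ~ in_path_map F p -> on_path (push F M) p = 0.
Proof.
move=> pF; apply/lfunP => v; rewrite zero_lfunE; apply/dsumP => w.
rewrite [v]at_sum linear_sum dsum_sum big1 => [|z _].
  by rewrite dsum0.
apply/eqP/negPn/negP => vw; apply: pF.
suff: lifts p (val z) (val w) by apply: lifts_in_path_map.
by apply: on_path_push_lifts vw => z' z'z; rewrite mk_dsumE (negPf z'z).
Qed.

Lemma is_module_push (I : ideal K Q) : compatible F I -> is_module I (push F M).
Proof.
move=> cF x y u Iu; have [r [c [rF ->]]] := cF x y u Iu.
rewrite on_kpath_sum big_seq big1 // => p pr.
by rewrite on_kpathZ on_kpathU on_path_push ?scaler0 //; apply: rF.
Qed.
End PushModule.

(** The right-hand side inherits the relations along the isomorphism, which settles that the sums of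
    strings and bands are modules over the quotient. *)
Lemma quot_iso_tensor (K : fieldType) (Q : quiver) (I : ideal K Q)
    (M M' N : qmod K Q) :
  semi_monomial I -> is_module I M -> is_module I M' ->
  qmod_iso (qtensor M M') N -> quot_iso I (qtensor M M') N.
Proof.
move=> sI IM IM' iso; have IT := is_module_tensor sI IM IM'.
by split=> //; apply: is_module_iso IT.
Qed.

(** * Components of fibre products *)

Lemma inj_surj_bijective (T T' : Type) (f : T -> T') :
  injective f -> (forall y, exists x, f x = y) -> bijective f.
Proof.
by move=> fI /choice[g gK]; exists g => // x; apply: fI; rewrite gK.
Qed.

Lemma bijective_preim (T T' : Type) (f : T -> T') :
  bijective f -> forall y, exists x, f x = y.
Proof. by case=> g _ gK y; exists (g y). Qed.

(** * Oriented walks in a component *)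

Section Orientation.
Variable P : quiver.
Implicit Types (o : arrow P -> bool) (C : {set vertex P}).

(** The direction of traversal [o] of the underlying graph may run against the arrows, as the arrows
    of a line or a cycle can point either way. *)
Definition ostart o a := if o a then qtail a else qhead a.
Definition oend o a := if o a then qhead a else qtail a.

Lemma ostartN o : ostart (fun a => ~~ o a) =1 oend o.
Proof. by move=> a; rewrite /ostart /oend if_neg. Qed.
Lemma oendN o : oend (fun a => ~~ o a) =1 ostart o.
Proof. by move=> a; rewrite /ostart /oend if_neg. Qed.

Lemma adjacent_sym : symmetric (@adjacent P).
Proof. by move=> x y; rewrite /adjacent; apply: eq_existsb => a; rewrite orbC. Qed.

Lemma adjacent_oriented o a : adjacent (ostart o a) (oend o a).
Proof.
by apply/existsP; exists a; rewrite /ostart /oend; case: (o a); rewrite !eqxx ?orbT.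
Qed.

Lemma adjacentP o x y :
  reflect (exists a, (ostart o a = x /\ oend o a = y) \/ (ostart o a = y /\ oend o a = x))
          (adjacent x y).
Proof.
apply: (iffP existsP) => -[a axy]; exists a.
  by rewrite /ostart /oend; case: (o a); case/orP: axy => /andP[/eqP-> /eqP->]; auto.
move: axy; rewrite /ostart /oend; case: (o a) => -[] [-> ->];
  by rewrite !eqxx ?orbT.
Qed.

Lemma component_connect C x y : C \in components P -> x \in C ->
  (y \in C) = connect (@adjacent P) x y.
Proof.
case/imsetP=> z _ ->; rewrite !inE => zx.
by rewrite (same_connect (sym_connect_sym adjacent_sym) zx).
Qed.

Lemma component_arrow o C a : C \in components P ->
  (oend o a \in C) = (ostart o a \in C).
Proof.
move=> CP; apply/idP/idP => aC; rewrite (component_connect _ CP aC) connect1 //.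
  by rewrite adjacent_sym adjacent_oriented.
exact: adjacent_oriented.
Qed.

Lemma component_head C a : C \in components P -> (qhead a \in C) = (qtail a \in C).
Proof. exact: (component_arrow (fun=> true)). Qed.

Lemma component_orient o C a : C \in components P -> (ostart o a \in C) = (qtail a \in C).
Proof. by move=> CP; rewrite /ostart; case: (o a); rewrite ?component_head. Qed.

Lemma component_of_vertex x : exists2 C, C \in components P & x \in C.
Proof.
by exists [set y | connect (@adjacent P) x y]; rewrite ?inE ?connect0 ?imset_f.
Qed.

Lemma component_eq C C' x : C \in components P -> C' \in components P ->
  x \in C -> x \in C' -> C = C'.
Proof.
move=> CP C'P xC xC'; apply/setP => y.
by rewrite (component_connect y CP xC) (component_connect y C'P xC').
Qed.

Lemma component_neq0 C : C \in components P -> exists x, x \in C.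
Proof. by case/imsetP=> x _ ->; exists x; rewrite inE connect0. Qed.

Lemma component_ind C (p : pred (vertex P)) x : C \in components P -> x \in C ->
  p x -> (forall y z, adjacent y z -> p y -> p z) -> forall y, y \in C -> p y.
Proof.
move=> CP xC px pstep y; rewrite (component_connect y CP xC) => /connectP[r + ->].
elim: r x px {xC} => //= z r IH x px /andP[xz]; apply: IH; exact: pstep px.
Qed.

Section Path.
Variable o : arrow P -> bool.
Hypotheses (start_inj : injective (ostart o)) (end_inj : injective (oend o)).
Variable y : vertex P.
Hypothesis source_y : forall a, oend o a <> y.

Let has x := [exists a, ostart o a == x].
(** The walk stands still at a vertex where no arrow starts; the hypotheses with [has] restrict
    attention to the part before that. *)
Let step x := if [pick a | ostart o a == x] is Some a then oend o a else x.

Let step_start a : step (ostart o a) = oend o a.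
Proof.
rewrite /step; case: pickP => [b /eqP /start_inj -> //|/(_ a)]; by rewrite eqxx.
Qed.

Let trail k := iter k step y.

Let trailS k : has (trail k) ->
  exists a, ostart o a = trail k /\ oend o a = trail k.+1.
Proof. by case/existsP=> a /eqP ak; exists a; split=> //; rewrite -step_start ak. Qed.

(** Injectivity of the ends traces a repetition back to [y], where no arrow ends. *)
Let trail_inj n : (forall k, (k < n)%N -> has (trail k)) ->
  forall i j, (i < j)%N -> (j <= n)%N -> trail i <> trail j.
Proof.
move=> hasn; elim=> [|i IH] [|j] // ij jn.
  by case: (trailS (hasn j jn)) => a [_ <-] /esym; apply: source_y.
have [a [ai <-]] := trailS (hasn i (ltn_trans (ij : (i < j)%N) jn)).
have [b [bj <-]] := trailS (hasn j jn).
by move/end_inj=> ab; apply: (IH j) => //; [apply: ltnW|rewrite -ai ab].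
Qed.

Let trail_stops : exists n, ~~ has (trail n).
Proof.
case: (EM (exists n, ~~ has (trail n))) => // nostop.
have hask k : has (trail k) by case hk: (has (trail k)) => //; case: nostop; exists k; rewrite hk.
pose f (i : 'I_#|vertex P|.+1) := trail i.
suff /leq_card : injective f by rewrite card_ord ltnn.
move=> i j fij; apply: val_inj => /=.
have tI i' j' : (i' < j')%N -> trail i' <> trail j'.
  by move=> ij'; apply: (@trail_inj j').
by case: (ltngtP i j) => // /tI; rewrite -/(f i) -/(f j) fij.
Qed.

(** The walk from the source [y] never repeats a vertex, so it stops; up to there it is a line, and
    being closed under adjacency it fills the component. *)
Lemma source_component_linear C : C \in components P -> y \in C ->
  is_linear (full_subquiver C).
Proof.
move=> CP yC; case: (ex_minnP trail_stops) => n nstop nmin.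
have hask k : (k < n)%N -> has (trail k).
  by move=> kn; case hk: (has (trail k)) => //; have := nmin k; rewrite hk leqNgt kn => /(_ isT).
have [ar arP] : exists ar : 'I_n -> arrow P,
    forall i : 'I_n, ostart o (ar i) = trail i /\ oend o (ar i) = trail i.+1.
  have /choice[ar arP] : forall i : 'I_n, exists a,
    ostart o a = trail i /\ oend o a = trail i.+1 by move=> i; apply/trailS/hask.
  by exists ar.
have trailC k : (k <= n)%N -> trail k \in C.
  elim: k => // k IH kn; have [ak <-] := arP (Ordinal kn).
  by rewrite component_arrow // ak IH // ltnW.
have Ctrail z : z \in C -> exists2 k : 'I_n.+1, trail k = z & True.
  have p0 : [exists k : 'I_n.+1, trail k == y] by apply/existsP; exists ord0.
  (* Forwards, an arrow starting at the vertex of index [k] forces [k < n], so the next vertex is on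
     the walk too. Backwards, an arrow ending at a later vertex is the one walked along, and none
     ends at [y]. *)
  suff pstep u w : adjacent u w -> [exists k : 'I_n.+1, trail k == u] ->
      [exists k : 'I_n.+1, trail k == w].
    by move/(component_ind CP yC p0 pstep) => /existsP[k /eqP kz]; exists k.
  move=> uw /existsP[k /eqP ku]; apply/existsP.
  have [a [] [au aw]] := adjacentP o u w uw.
    have kn : (k < n)%N.
      rewrite ltn_neqAle -ltnS ltn_ord andbT; apply: contraNneq nstop => <-.
      by apply/existsP; exists a; rewrite au -ku.
    by exists (lift ord0 (Ordinal kn)); rewrite -aw -step_start au -ku.
  case: k ku => -[|k] kn /= ku; first by case: (source_y (a := a)); rewrite aw -ku.
  have [ak akS] := arP (Ordinal (kn : (k < n)%N)).
  have ara : ar (Ordinal (kn : (k < n)%N)) = a by apply: end_inj; rewrite akS aw.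
  by exists (widen_ord (leqnSn n) (Ordinal (kn : (k < n)%N))); rewrite -au -ara ak.
have vC (i : 'I_n.+1) : trail i \in C by rewrite trailC // -ltnS.
have aC (i : 'I_n) : (qtail (ar i) \in C) && (qhead (ar i) \in C).
  rewrite component_head // andbb -(component_orient o) //; case: (arP i) => -> _.
  by rewrite trailC // ltnW.
exists n, (fun i : 'I_n.+1 => Sub (trail i) (vC i) : full_vertex C),
  (fun i : 'I_n => Sub (ar i) (aC i) : full_arrow C); split=> [||i].
- apply: inj_surj_bijective => [i j /(congr1 val) /= ij|z].
    apply: val_inj; case: (ltngtP i j) => // /(trail_inj hask) tij.
      by case: tij; rewrite // -ltnS.
    by case: tij; rewrite // -ltnS.
  by have [k kz _] := Ctrail _ (valP z); exists k; apply: val_inj.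
- apply: inj_surj_bijective => [i j /(congr1 val) /= ij|b].
    have [[ai _] [aj _]] := (arP i, arP j); rewrite ij aj in ai.
    apply: val_inj; case: (ltngtP i j) => // /(trail_inj hask) tij.
      by case: tij; rewrite // ltnW.
    by case: tij; rewrite // ltnW.
  have /andP[bC _] := valP b; rewrite -(component_orient o) // in bC.
  have [k kb _] := Ctrail _ bC.
  have kn : (k < n)%N.
    rewrite ltn_neqAle -ltnS ltn_ord andbT; apply: contraNneq nstop => <-.
    by apply/existsP; exists (val b); rewrite kb.
  exists (Ordinal kn); apply: val_inj; apply: start_inj.
  by case: (arP (Ordinal kn)) => -> _.
have [] := arP i; rewrite /ostart /oend /joins; case: (o (ar i)) => ai aiS.
  by left; split; apply: val_inj.
by right; split; apply: val_inj.
Qed.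
End Path.

(** A vertex where no arrow starts is a source for the reversed orientation. *)
Lemma component_linear_or_total o C :
  injective (ostart o) -> injective (oend o) -> C \in components P ->
  is_linear (full_subquiver C) \/ (forall x, x \in C -> exists a, ostart o a = x).
Proof.
move=> sI eI CP; case: (EM (is_linear (full_subquiver C))) => [|nlin]; first by left.
right=> x xC; case: (EM (exists a, ostart o a = x)) => // nox; case: nlin.
apply: (@source_component_linear (fun a => ~~ o a) _ _ x) => //.
- by apply: eq_inj eI _ => a; rewrite ostartN.
- by apply: eq_inj sI _ => a; rewrite oendN.
by move=> a; rewrite oendN => ax; apply: nox; exists a.
Qed.

(** Choosing an arrow at each start embeds the vertices into the arrows, but a line has one arrow
    fewer than vertices. *)
Lemma total_component_not_linear o C : C \in components P ->
  (forall x, x \in C -> exists a, ostart o a = x) -> ~ is_linear (full_subquiver C).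
Proof.
move=> CP tot [n [v [a [vbij abij _]]]].
have /choice[f fx] : forall x : full_vertex C, exists b : full_arrow C,
    ostart o (val b) = val x.
  move=> x; have [b bx] := tot _ (valP x).
  have bC : (qtail b \in C) && (qhead b \in C).
    by rewrite component_head // andbb -(component_orient o) // bx (valP x).
  by exists (Sub b bC).
have fI : injective f by move=> x x' fxx; apply: val_inj; rewrite -!fx fxx.
have := leq_card f fI.
by rewrite -(bij_eq_card vbij) -(bij_eq_card abij) !card_ord ltnn.
Qed.
End Orientation.

(** * Coherent orientations of lines and cycles *)

Lemma linear_orientation (P : quiver) : is_linear P ->
  exists o (f : vertex P -> nat), [/\ injective (ostart o), injective (oend o) &
    forall a, f (oend o a) = (f (ostart o a)).+1].
Proof.
case=> n [v [a [vbij [a' aK a'K] aJ]]]; have vI := bij_inj vbij; have [v' vK v'K] := vbij.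
pose o b := qtail b == v (widen_ord (leqnSn n) (a' b)).
have oP i : ostart o (a i) = v (widen_ord (leqnSn n) i) /\ oend o (a i) = v (lift ord0 i).
  rewrite /ostart /oend /o aK; case: (aJ i) => -[-> ->]; rewrite ?eqxx //.
  rewrite (inj_eq vI) -val_eqE /= /bump leq0n add1n gtn_eqF //.
exists o, (fun x => v' x); split=> [b c|b c|b].
- rewrite -[b]a'K -[c]a'K; have [[-> _] [-> _]] := (oP (a' b), oP (a' c)).
  by move/vI/(congr1 val) => /= /val_inj->.
- rewrite -[b]a'K -[c]a'K; have [[_ ->] [_ ->]] := (oP (a' b), oP (a' c)).
  by move/vI/lift_inj->.
by rewrite -[b]a'K; have [-> ->] := oP (a' b); rewrite !vK.
Qed.

(** A coherent orientation [o] of a cycle: [nxt] rotates its arrows by one step. *)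
Definition cyclic_order (P : quiver) (o : arrow P -> bool) (nxt : arrow P -> arrow P) :=
  [/\ bijective (ostart o), injective nxt,
      forall a, ostart o (nxt a) = oend o a & forall a b, fconnect nxt a b].

Lemma cyclic_orientation (P : quiver) : is_cyclic P ->
  exists o nxt, @cyclic_order P o nxt.
Proof.
case=> n [v [a [vbij [a' aK a'K] aJ]]]; have vI := bij_inj vbij; have [v' vK v'K] := vbij.
pose o b := qtail b == v (a' b).
have oP i : ostart o (a i) = v i /\ oend o (a i) = v (ordS i).
  rewrite /ostart /oend /o aK; case: (aJ i) => -[-> ->]; rewrite ?eqxx //.
  (* On a single loop both ends of the edge coincide, and the test defining [o] succeeds for an edge
     listed in reverse as well. *)
  by case: eqP => // ->.
have sE b : ostart o b = v (a' b) by rewrite -{1}[b]a'K; case: (oP (a' b)).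
exists o, (fun b => a (ordS (a' b))); split.
- exists (fun x => a (v' x)) => [b|x]; first by rewrite sE vK a'K.
  by rewrite sE aK v'K.
- by move=> b c /(can_inj aK)/ordS_inj/(can_inj a'K).
- by move=> b; rewrite sE aK -[b in RHS]a'K; case: (oP (a' b)).
move=> b c; pose nxt b := a (ordS (a' b)).
have iterE k : a' (iter k nxt b) = ((a' b + k) %% n.+1)%N :> nat.
  elim: k => [|k IH]; first by rewrite addn0 modn_small.
  by rewrite iterS {1}/nxt aK /= IH addnS -[(_ %% _).+1]addn1 modnDml addn1.
(* The exponent is the distance from [b] to [c] modulo [n.+1], written so that the subtraction does
   not truncate. *)
have -> : c = iter (a' c + (n.+1 - a' b)) nxt b.
  apply: (can_inj a'K); apply: val_inj; rewrite /= iterE addnCA subnKC; last exact: ltnW.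
  by rewrite modnDr modn_small.
exact: fconnect_iter.
Qed.

Lemma cyclic_orderN (P : quiver) (o : arrow P -> bool) nxt :
  cyclic_order o nxt -> cyclic_order (fun a => ~~ o a) (finv nxt).
Proof.
case=> sbij nI sn nc; have eE : ostart o \o nxt =1 oend o by move=> a; rewrite /= sn.
split.
- by apply: (eq_bij (bij_comp sbij (injF_bij nI))) => a; rewrite ostartN eE.
- exact: finv_inj.
- by move=> a; rewrite ostartN oendN -sn f_finv.
by move=> a b; rewrite same_fconnect_finv.
Qed.

Lemma iter_inj (T : Type) (f : T -> T) k : injective f -> injective (iter k f).
Proof. by move=> fI; elim: k => [|k IH] x y //= /fI/IH. Qed.

Section CyclicMorphism.
Variables (Z Z' : quiver) (o : arrow Z -> bool) (o' : arrow Z' -> bool).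
Variables (nxt : arrow Z -> arrow Z) (nxt' : arrow Z' -> arrow Z').
Hypotheses (cZ : cyclic_order o nxt) (cZ' : cyclic_order o' nxt').

(** Each vertex starts exactly one arrow, so [f] determines the map on vertices. Agreement of [o]
    and [o'] turns compatibility with starts and ends into compatibility with tails and heads. *)
Lemma cyclic_qhom (f : arrow Z -> arrow Z') :
  (forall a, f (nxt a) = nxt' (f a)) -> (forall a, o' (f a) = o a) -> bijective f ->
  exists s : qhom Z Z', qhom_iso s /\ on_arrow s =1 f /\
    forall a, s (ostart o a) = ostart o' (f a).
Proof.
move=> fn fo fbij; case: cZ cZ' => -[g gK Kg] nI sn _ [s'bij _ s'n _].
pose sv x := ostart o' (f (g x)).
have svs a : sv (ostart o a) = ostart o' (f a) by rewrite /sv gK.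
have sve a : sv (oend o a) = oend o' (f a) by rewrite -sn svs fn s'n.
have st a : qtail (f a) = sv (qtail a).
  have := svs a; have := sve a; rewrite /ostart /oend fo; by case: (o a) => [_|] ->.
have sh a : qhead (f a) = sv (qhead a).
  have := svs a; have := sve a; rewrite /ostart /oend fo; by case: (o a) => [|_] ->.
exists (QHom st sh); do 2!split=> //.
by apply: bij_comp s'bij (bij_comp fbij _); exists (ostart o).
Qed.

Lemma cyclic_qhom_over (Q : quiver) (G : qhom Z Q) (G' : qhom Z' Q) (s : qhom Z Z') f :
  on_arrow s =1 f -> (forall a, s (ostart o a) = ostart o' (f a)) ->
  (forall a, o' (f a) = o a) -> (forall a, on_arrow G' (f a) = on_arrow G a) ->
  qhom_eq G (qhom_comp G' s).
Proof.
case: cZ => -[g gK Kg] _ _ _ sf ss fo fG; split=> [x|a] /=; last by rewrite sf fG.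
rewrite -[x]Kg ss /ostart fo; case: (o _); first by rewrite -!qhom_tail fG.
by rewrite -!qhom_head fG.
Qed.
End CyclicMorphism.

(** * Parallel walks round two cycles *)

Section Unwinding.
Variables (Q : quiver).

(** Walking round both cycles in parallel and reading the same arrows of [Q] makes the
    rotation of the first by a period of the second an automorphism. *)
Lemma parallel_period (G G' : qshape Q) o o' nxt nxt' (a : arrow (sdom G))
    (a' : arrow (sdom G')) (m : nat) :
  trivial_aut G -> @cyclic_order (sdom G) o nxt -> @cyclic_order (sdom G') o' nxt' ->
  (forall k, on_arrow G (iter k nxt a) = on_arrow G' (iter k nxt' a')) ->
  (forall k, o (iter k nxt a) = o' (iter k nxt' a')) ->
  iter m nxt' a' = a' -> iter m nxt a = a.
Proof.
move=> autG cZ cZ' Gk ok ma'; pose f := iter m nxt.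
have [_ nI _ nc] := cZ.
have reach b : exists k, b = iter k nxt a.
  by exists (findex nxt a b); rewrite iter_findex.
have shift k : iter (m + k) nxt' a' = iter k nxt' a' by rewrite addnC iterD ma'.
have fo b : o (f b) = o b.
  by have [k ->] := reach b; rewrite /f -iterD !ok shift.
have fG b : on_arrow G (f b) = on_arrow G b.
  by have [k ->] := reach b; rewrite /f -iterD !Gk shift.
have fI : injective f by apply: iter_inj.
have [|s [siso [sf ss]]] := cyclic_qhom cZ cZ _ fo (injF_bij fI).
  by move=> b; rewrite /f -iterSr.
have [_ sid] := autG s siso (cyclic_qhom_over cZ sf ss fo fG).
by rewrite -/(f a) -sf sid.
Qed.

(** By [parallel_period] in both directions the walks from [a] and [a'] have the same periods, so
    matching their steps of equal number is a well-defined bijection. *)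
Lemma parallel_iso (G G' : qshape Q) o o' nxt nxt' (a : arrow (sdom G))
    (a' : arrow (sdom G')) :
  trivial_aut G -> trivial_aut G' ->
  @cyclic_order (sdom G) o nxt -> @cyclic_order (sdom G') o' nxt' ->
  (forall k, on_arrow G (iter k nxt a) = on_arrow G' (iter k nxt' a')) ->
  (forall k, o (iter k nxt a) = o' (iter k nxt' a')) ->
  exists s : qhom (sdom G) (sdom G'),
    [/\ qhom_iso s, qhom_eq G (qhom_comp G' s) & on_arrow s a = a'].
Proof.
move=> autG autG' cZ cZ' Gk ok.
have [[_ nI _ nc] [_ nI' _ nc']] := (cZ, cZ').
have per m : iter m nxt' a' = a' <-> iter m nxt a = a.
  by split; [apply: (parallel_period autG cZ cZ')|apply: (parallel_period autG' cZ' cZ)].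
have iter_eq i k : iter i nxt a = iter k nxt a <-> iter i nxt' a' = iter k nxt' a'.
  wlog ik : i k / (i <= k)%N.
    by move=> H; case/orP: (leq_total i k) => /H // [H1 H2]; split=> /esym => [/H1|/H2] ->.
  rewrite -(subnKC ik) !iterD; split=> e; congr iter; apply/esym/per/esym.
    by apply: iter_inj e.
  by apply: iter_inj e.
pose f b := iter (findex nxt a b) nxt' a'.
have fk k : f (iter k nxt a) = iter k nxt' a' by apply/iter_eq; rewrite iter_findex.
have reach b : exists k, b = iter k nxt a.
  by exists (findex nxt a b); rewrite iter_findex.
have fbij : bijective f.
  apply: inj_surj_bijective => [b c|b'].
    by have [[i ->] [k ->]] := (reach b, reach c); rewrite !fk => /iter_eq.
  by exists (iter (findex nxt' a' b') nxt a); rewrite fk iter_findex.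
have fo b : o' (f b) = o b by have [k ->] := reach b; rewrite fk ok.
have fG b : on_arrow G' (f b) = on_arrow G b by have [k ->] := reach b; rewrite fk Gk.
have [|s [siso [sf ss]]] := cyclic_qhom cZ cZ' _ fo fbij.
  by move=> b; have [k ->] := reach b; rewrite -[nxt _]/(iter k.+1 nxt a) !fk.
exists s; split=> //; first exact (cyclic_qhom_over cZ sf ss fo fG).
by rewrite sf -[a in LHS]/(iter 0 nxt a) fk.
Qed.
End Unwinding.

(** * Components of the fibre product over a line and over two cycles *)

Section FibreProductOrientation.
Variables (Q : quiver) (F F' : qshape Q).
Local Notation FP := (fibre_product F F').

Lemma strict_start_inj (P : quiver) (G : qhom P Q) (b : bool) (a a' : arrow P) :
  is_strict G -> on_arrow G a = on_arrow G a' ->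
  (if b then qtail a else qhead a) = (if b then qtail a' else qhead a') -> a = a'.
Proof.
move=> sG Gaa; case: (EM (a = a')) => // naa; have [ht hh] := sG _ _ naa Gaa.
by case: b.
Qed.

(** The first coordinates agree by injectivity of [ostart o]. The second coordinates then have the
    same image in [Q] and share an end, so strictness of [F'] identifies them. *)
Lemma fp_start_inj1 (o : arrow (sdom F) -> bool) : injective (ostart o) ->
  injective (ostart (fun a : arrow FP => o (val a).1)).
Proof.
move=> oI a b ab.
have ab1 : (val a).1 = (val b).1.
  apply: oI; move: (congr1 (fun x : vertex FP => (val x).1) ab); rewrite /ostart.
  by case: (o (val a).1); case: (o (val b).1).
apply: val_inj; apply/eqP; rewrite -pair_eqE /= ab1 eqxx /=; apply/eqP.
apply: (strict_start_inj (b := o (val a).1) (@shape_strict _ F')).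
  by rewrite -(eqP (valP a)) -(eqP (valP b)) ab1.
move: (congr1 (fun x : vertex FP => (val x).2) ab); rewrite /ostart ab1.
by case: (o _).
Qed.

Lemma fp_start_inj2 (o : arrow (sdom F') -> bool) : injective (ostart o) ->
  injective (ostart (fun a : arrow FP => o (val a).2)).
Proof.
move=> oI a b ab.
have ab2 : (val a).2 = (val b).2.
  apply: oI; move: (congr1 (fun x : vertex FP => (val x).2) ab); rewrite /ostart.
  by case: (o (val a).2); case: (o (val b).2).
apply: val_inj; apply/eqP; rewrite -pair_eqE /= ab2 eqxx andbT; apply/eqP.
apply: (strict_start_inj (b := o (val a).2) (@shape_strict _ F)).
  by rewrite (eqP (valP a)) (eqP (valP b)) ab2.
move: (congr1 (fun x : vertex FP => (val x).1) ab); rewrite /ostart ab2.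
by case: (o _).
Qed.

Lemma fp_end_inj1 (o : arrow (sdom F) -> bool) : injective (oend o) ->
  injective (oend (fun a : arrow FP => o (val a).1)).
Proof.
move=> oI; apply: eq_inj (fp_start_inj1 (o := fun a => ~~ o a) _) _; last exact: ostartN.
by apply: eq_inj oI _ => a; rewrite ostartN.
Qed.

Lemma fp_end_inj2 (o : arrow (sdom F') -> bool) : injective (oend o) ->
  injective (oend (fun a : arrow FP => o (val a).2)).
Proof.
move=> oI; apply: eq_inj (fp_start_inj2 (o := fun a => ~~ o a) _) _; last exact: ostartN.
by apply: eq_inj oI _ => a; rewrite ostartN.
Qed.

(** Every oriented arrow raises the position [f] on the line, so no arrow starts at a vertex of
    maximal position in the component. *)
Lemma fp_component_linear C : linear_shape F -> C \in components FP ->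
  is_linear (full_subquiver C).
Proof.
move=> /linear_orientation[o [f [sI eI fS]]] CP.
have [//|tot] := component_linear_or_total (fp_start_inj1 sI) (fp_end_inj1 eI) CP.
have [x xC] := component_neq0 CP.
have [y yC ymax] := arg_maxnP (fun x : vertex FP => f (val x).1) xC.
have [a ay] := tot y yC.
have : oend (fun a : arrow FP => o (val a).1) a \in C by rewrite component_arrow // ay.
move/ymax; rewrite -ay /=.
have -> : (val (oend (fun a : arrow FP => o (val a).1) a)).1 = oend o (val a).1.
  by rewrite /oend; case: (o _).
have -> : (val (ostart (fun a : arrow FP => o (val a).1) a)).1 = ostart o (val a).1.
  by rewrite /ostart; case: (o _).
by rewrite fS ltnn.
Qed.
End FibreProductOrientation.

Section CyclicProduct.
Variables (Q : quiver) (G G' : qshape Q).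
Local Notation FP := (fibre_product G G').
Variables (o : arrow (sdom G) -> bool) (nxt : arrow (sdom G) -> arrow (sdom G)).
Hypothesis cZ : cyclic_order o nxt.
Let fo (e : arrow FP) := o (val e).1.

Section Parallel.
Variables (o' : arrow (sdom G') -> bool) (nxt' : arrow (sdom G') -> arrow (sdom G')).
Hypothesis cZ' : cyclic_order o' nxt'.
Let fo' (e : arrow FP) := o' (val e).2.

(** If the two orientations disagreed on [f], then for the second one [f] would end where [e] ends,
    hence equal [e], on which they agree. *)
Lemma fp_next (e f : arrow FP) : fo e = fo' e -> ostart fo f = oend fo e ->
  val f = (nxt (val e).1, nxt' (val e).2) /\ fo f = fo' f.
Proof.
move=> oe ef; have [[sbij nI sn _] [s'bij nI' s'n _]] := (cZ, cZ').
have of' : fo f = fo' f.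
  case: (eqVneq (fo f) (fo' f)) => // off.
  suff fe : f = e by rewrite fe oe eqxx in off.
  have e'I : injective (oend o').
    move=> a b; rewrite -!s'n => /(bij_inj s'bij); exact: nI'.
  apply: (fp_end_inj2 e'I); rewrite -/fo'.
  have -> : oend fo' f = ostart fo f.
    by move: off; rewrite /oend /ostart; case: (fo f); case: (fo' f).
  by rewrite ef /oend oe.
split=> //; rewrite [LHS]surjective_pairing; congr pair.
  apply: (bij_inj sbij); rewrite sn.
  move: (congr1 (fun x : vertex FP => (val x).1) ef); rewrite /ostart /oend /fo.
  by case: (o (val f).1); case: (o (val e).1).
apply: (bij_inj s'bij); rewrite s'n.
move: (congr1 (fun x : vertex FP => (val x).2) ef); rewrite /ostart /oend of' oe /fo'.
by case: (o' (val f).2); case: (o' (val e).2).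
Qed.

Lemma fp_walk (C : {set vertex FP}) (e : arrow FP) : C \in components FP ->
  (forall x, x \in C -> exists a, ostart fo a = x) -> ostart fo e \in C ->
  fo e = fo' e -> forall k, exists f : arrow FP,
    [/\ val f = (iter k nxt (val e).1, iter k nxt' (val e).2),
        ostart fo f \in C & fo f = fo' f].
Proof.
move=> CP tot eC oe; elim=> [|k [f [fE fC of']]].
  by exists e; split=> //; case: (val e).
have [|f1 f1E] := tot (oend fo f); first by rewrite component_arrow.
have [f1v of1] := fp_next of' f1E.
by exists f1; split=> //; [rewrite f1v fE|rewrite f1E component_arrow].
Qed.
End Parallel.
End CyclicProduct.

(** The arrow [e] ties the isomorphism to the given vertex [x]: if both shapes are the same and [s]
    is the identity, it places [x] on the diagonal. *)
Lemma fp_nonlinear_iso (Q : quiver) (G G' : qshape Q)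
    (C : {set vertex (fibre_product G G')}) :
  cyclic_shape G -> cyclic_shape G' -> C \in components (fibre_product G G') ->
  ~ is_linear (full_subquiver C) -> forall x, x \in C ->
  exists (s : qhom (sdom G) (sdom G')), [/\ qhom_iso s, qhom_eq G (qhom_comp G' s) &
    exists e : arrow (fibre_product G G'), [/\ qtail e = x \/ qhead e = x &
      on_arrow s (val e).1 = (val e).2]].
Proof.
move=> [/cyclic_orientation[o [nxt cZ]] autG].
move=> [/cyclic_orientation[o'0 [nxt'0 cZ'0]] autG'] CP nlin x xC.
have [sbij nI sn _] := cZ.
have eI : injective (oend o) by move=> a b; rewrite -!sn => /(bij_inj sbij)/nI.
case: (component_linear_or_total (fp_start_inj1 (bij_inj sbij)) (fp_end_inj1 eI) CP).
  by [].
move=> tot; have [e ex] := tot x xC.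
(* The second cycle is read backwards if necessary, so that both readings traverse [e] the same
   way. *)
have [o' [nxt' [cZ' oe]]] : exists o' nxt',
    cyclic_order o' nxt' /\ o (val e).1 = o' (val e).2.
  case: (eqVneq (o (val e).1) (o'0 (val e).2)) => oe; first by exists o'0, nxt'0.
  exists (fun a => ~~ o'0 a), (finv nxt'0); split; first exact: cyclic_orderN.
  by move: oe; case: (o _); case: (o'0 _).
have walk := fp_walk cZ cZ' CP tot (etrans (congr1 (fun x => x \in C) ex) xC) oe.
have [k|k|s [siso sG se]] := parallel_iso (a := (val e).1) (a' := (val e).2)
    autG autG' cZ cZ'.
- have [f [fE _ _]] := walk k; have := eqP (valP f); by rewrite fE.
- have [f [fE _]] := walk k; by rewrite fE.
exists s; split=> //; exists e; split=> //.
by move: ex; rewrite /ostart; case: (o _); [left|right].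
Qed.

Section SelfProduct.
Variables (Q : quiver) (G : qshape Q).
Local Notation FP := (fibre_product G G).
Hypothesis cG : cyclic_shape G.
Implicit Type C : {set vertex FP}.

Definition fp_diag (x : vertex FP) := (val x).1 == (val x).2.

Lemma fp_nonlinear_diag C x : C \in components FP -> ~ is_linear (full_subquiver C) ->
  x \in C -> fp_diag x.
Proof.
move=> CP nlin xC.
have [s [siso sG [e [ex se]]]] := fp_nonlinear_iso cG cG CP nlin xC.
have [_ sid] := (proj2 cG) s siso sG; rewrite sid in se.
by rewrite /fp_diag; case: ex => <- /=; rewrite se.
Qed.

Lemma fp_diag_arrow (e : arrow FP) : fp_diag (qtail e) || fp_diag (qhead e) ->
  (val e).1 = (val e).2.
Proof.
have Ge := eqP (valP e); case/orP => /eqP /= ee.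
  exact: (strict_start_inj (b := true) (@shape_strict _ G) Ge).
exact: (strict_start_inj (b := false) (@shape_strict _ G) Ge).
Qed.

(** Strictness keeps the whole component on the diagonal, where the arrows of the cycle provide one
    starting at every vertex. *)
Lemma fp_diag_nonlinear C x : C \in components FP -> x \in C -> fp_diag x ->
  ~ is_linear (full_subquiver C).
Proof.
move=> CP xC dx; have [o [nxt [sbij _ _ _]]] := cyclic_orientation (proj1 cG).
have diagC : forall y, y \in C -> fp_diag y.
  apply: (component_ind CP xC dx) => y z /existsP[e yz] dy.
  have ee : (val e).1 = (val e).2.
    apply: fp_diag_arrow; case/orP: yz => /andP[/eqP yE /eqP zE];
      by rewrite ?yE ?zE dy ?orbT.
  by case/orP: yz => /andP[/eqP yE /eqP zE]; rewrite /fp_diag -?yE -?zE /= ee.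
apply: (total_component_not_linear (o := fun e : arrow FP => o (val e).1)) => // y yC.
have /eqP dy := diagC y yC; have [a ay] := bijective_preim sbij (val y).1.
have aP : on_arrow G (a, a).1 == on_arrow G (a, a).2 by [].
exists (Sub (a, a) aP); apply: val_inj; rewrite [RHS]surjective_pairing -dy -ay.
by rewrite /ostart /=; case: (o a).
Qed.
End SelfProduct.

Lemma fp_noniso_linear (Q : quiver) (G G' : qshape Q)
    (C : {set vertex (fibre_product G G')}) :
  cyclic_shape G -> cyclic_shape G' -> ~ shape_iso G G' ->
  C \in components (fibre_product G G') -> is_linear (full_subquiver C).
Proof.
move=> cG cG' noiso CP; case: (EM (is_linear (full_subquiver C))) => // nlin.
have [x xC] := component_neq0 CP.
have [s [siso sG _]] := fp_nonlinear_iso cG cG' CP nlin xC.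
by case: noiso; exists s.
Qed.

(** * Gauge fixing and decomposition *)

Section Gauge.
Variable K : fieldType.

Lemma jordan_unit (a : K) (s : nat) : a != 0 -> jordan a s \in unitmx.
Proof.
move=> a0; rewrite -unitmx_tr unitmxE det_trig; last first.
  apply/is_trig_mxP => i j ij; rewrite !mxE -val_eqE /= gtn_eqF // ifN //.
  by rewrite ltn_eqF // ltnW // ltnS.
by rewrite unitfE; apply/prodf_neq0 => i _; rewrite !mxE eqxx.
Qed.

Lemma band_twist_unit (s : nat) (a : K) (Z : quiver) (g al : arrow Z) :
  a != 0 -> band_twist s a g al \in unitmx.
Proof. by move=> a0; rewrite /band_twist; case: ifP; rewrite ?jordan_unit ?unitmx1. Qed.

(** The equation is solved along the line from the identity at its first vertex; each edge
    contributes its matrix or the inverse, according to its direction. *)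
Lemma linear_gauge (P : quiver) (d : nat) (D : arrow P -> 'M[K]_d) :
  is_linear P -> (forall a, D a \in unitmx) -> exists T : vertex P -> 'M[K]_d,
  (forall x, T x \in unitmx) /\ (forall a, D a *m T (qtail a) = T (qhead a)).
Proof.
case=> n [v [a [[v' vK v'K] [a' aK a'K] aJ]]] Du.
pose E i := if qtail (a i) == v (widen_ord (leqnSn n) i) then D (a i) else invmx (D (a i)).
(* The recursion is on natural numbers, and [insub] recovers the index of an edge; its default
   [1%:M] is not reached at the positions of vertices. *)
pose W := fix W k : 'M[K]_d :=
  if k is k'.+1 then (if insub k' is Some i then E i else 1%:M) *m W k' else 1%:M.
have Eu i : E i \in unitmx by rewrite /E; case: ifP; rewrite ?unitmx_inv Du.
exists (fun x => W (v' x)); split=> [x|b].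
  elim: (nat_of_ord (v' x)) => [|k IH] /=; first exact: unitmx1.
  by rewrite unitmx_mul IH andbT; case: insubP => *; rewrite ?unitmx1 ?Eu.
rewrite -[b]a'K; set i := a' b.
have WS : W (lift ord0 i) = E i *m W (widen_ord (leqnSn n) i).
  by rewrite /= valK.
have [[ti hi]|[ti hi]] := aJ i; rewrite ti hi !vK WS /E ti; first by rewrite eqxx.
rewrite ifN ?mulKVmx //; apply/negP => /eqP/(can_inj vK)/(congr1 val) /=.
by move/eqP; rewrite gtn_eqF.
Qed.

(** Glues the gauges of the linear components and leaves the matrices on all other components
    unchanged. *)
Lemma component_gauge (P : quiver) (d : nat) (D : arrow P -> 'M[K]_d) :
  (forall a, D a \in unitmx) -> exists T : vertex P -> 'M[K]_d,
  [/\ forall x, T x \in unitmx,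
      forall C a, C \in components P -> is_linear (full_subquiver C) ->
        qtail a \in C -> D a *m T (qtail a) = T (qhead a) &
      forall C x, C \in components P -> ~ is_linear (full_subquiver C) ->
        x \in C -> T x = 1%:M].
Proof.
move=> Du; have /choice[t tP] : forall C : {set vertex P}, exists t : vertex P -> 'M[K]_d,
    [/\ forall x, t x \in unitmx,
      C \in components P -> is_linear (full_subquiver C) ->
        forall a, qtail a \in C -> D a *m t (qtail a) = t (qhead a) &
      ~ is_linear (full_subquiver C) -> forall x, t x = 1%:M].
  move=> C; case: (EM (is_linear (full_subquiver C))) => [lin|nlin]; last first.
    by exists (fun=> 1%:M); split=> // x; apply: unitmx1.
  have [|t [tu tD]] := linear_gauge (D := fun a : arrow (full_subquiver C) => D (val a)) lin.
    by move=> a; apply: Du.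
  exists (fun x => if insub x is Some x' then t x' else 1%:M); split=> //.
    by move=> x; case: insubP => *; rewrite ?unitmx1 ?tu.
  move=> CP _ a aC; have hC : qhead a \in C by rewrite component_head.
  have aP : (qtail a \in C) && (qhead a \in C) by rewrite aC.
  pose b : arrow (full_subquiver C) := Sub a aP.
  have st : insub (qtail a) = Some (qtail b : full_vertex C) by rewrite -[RHS]valK.
  have sh : insub (qhead a) = Some (qhead b : full_vertex C) by rewrite -[RHS]valK.
  rewrite st sh; exact: (tD b).
have /choice[c cP] : forall x, exists C, C \in components P /\ x \in C.
  by move=> x; have [C CP xC] := component_of_vertex x; exists C.
have cE C x : C \in components P -> x \in C -> c x = C.
  by move=> CP xC; have [cxP xc] := cP x; apply: component_eq xc xC.
exists (fun x => t (c x) x); split=> [x|C a CP lin aC|C x CP nlin xC].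
- by have [] := tP (c x).
- rewrite (cE C) // (cE C (qhead a)) ?component_head //.
  by have [_ + _] := tP C; apply.
by rewrite (cE C) //; have [_ _] := tP C; apply.
Qed.
End Gauge.

(** * Sums of strings over the linear components *)

Section LinearPart.
Variables (K : fieldType) (Q : quiver).

Lemma presentation_copies (M : qmod K Q) (d : nat) (B : finType) (pos : B -> vertex Q)
    (coef : arrow Q -> B -> B -> K) :
  presentation M pos coef ->
  presentation (qcopies d M) (fun c : B * 'I_d => pos c.1)
    (fun a c' c => if c'.2 == c.2 then coef a c'.1 c.1 else 0).
Proof.
move=> p; have ps := presentation_sum (fun _ : 'I_d => p).
apply: (presentation_relabel ps (h := fun c : B * 'I_d => existT (fun=> B : Type) c.2 c.1)) => //.
  by exists (fun c : {_ : 'I_d & B} => (tagged c : B, tag c)); case.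
move=> a [b i] [b' j] _ _ /=; case: eqVneq => [<-|ij]; last first.
  by rewrite untag_dflt //= eq_sym.
by rewrite (untagE _ _ (erefl : tag (existT (fun=> B : Type) j b) = j)).
Qed.

Lemma twisted_copies (F : qshape Q) (d : nat) :
  twisted (qcopies d (string_mod K F)) F (fun=> 1%:M : 'M_d).
Proof.
have p := presentation_copies d (twisted_string K F).
apply: (presentation_relabel p
  (h := fun c : vertex (sdom F) * 'I_d => ((c.1, ord0), c.2))) => //.
  exists (fun c : vertex (sdom F) * 'I_1 * 'I_d => (c.1.1, c.2)); first by case.
  by case=> [[x i] j]; rewrite /= (ord1 i).
move=> a [x i] [y j] _ _; rewrite /twist_coef /=; case: eqVneq => [->|ij].
  by apply: eq_bigr => al _; rewrite !mxE !eqxx.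
by rewrite big1 // => al _; rewrite mxE (negPf ij).
Qed.

Section Component.
Variables (P : quiver) (F : qhom P Q) (d : nat) (D : arrow P -> 'M[K]_d).
Implicit Type C : {set vertex P}.

Lemma twist_coef_component C (E : arrow (full_subquiver C) -> 'M[K]_d) a
    (x y : full_vertex C) i j :
  (forall al, E al = D (val al)) ->
  twist_coef (qhom_comp F (full_incl C)) E a (y, j) (x, i) =
  twist_coef F D a (val y, j) (val x, i).
Proof.
move=> ED; rewrite /twist_coef /=.
rewrite [RHS](reindex_omap (val : full_arrow C -> _) insub) /= => [|al]; last first.
  by case/and3P=> /eqP alx /eqP aly _; rewrite insubT // alx aly (valP x) (valP y).
by apply: eq_big => [al|al _]; rewrite ?ED // valK eqxx andbT.
Qed.

Lemma twist_coef_separate C C' a x y i j : C \in components P -> C' \in components P ->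
  x \in C -> y \in C' -> C <> C' -> twist_coef F D a (y, j) (x, i) = 0.
Proof.
move=> CP C'P xC yC' CC'; rewrite /twist_coef big_pred0 // => al /=.
apply/negP => /and3P[/eqP alx /eqP aly _]; case: CC'.
by apply: (component_eq CP C'P _ yC'); rewrite -aly component_head // alx.
Qed.
End Component.

Section LinearComponents.
Variables (F F' : qshape Q) (d : nat).
Local Notation FP := (fibre_product F F').
Local Notation H := (qhom_comp F (fp_proj1 F F')).

Definition lin_basis : finType :=
  {C : linear_components F F' & vertex (sdom (fp_shape (val C))) * 'I_d}%type.

Definition lin_vertex (b : lin_basis) : vertex FP := val (tagged b).1.

Lemma lin_component (C : linear_components F F') :
  val C \in components FP /\ is_linear (full_subquiver (val C)).
Proof. by case/andP: (valP C) => CP /asboolP. Qed.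

Lemma lin_vertexP (b : lin_basis) : lin_vertex b \in val (tag b).
Proof. exact: valP. Qed.

Lemma lin_basis_inj : injective (fun b : lin_basis => (lin_vertex b, (tagged b).2)).
Proof.
case=> [C [x i]] [C' [x' i']] /= [xx' ->]; rewrite /lin_vertex /= in xx'.
have CC' : C = C'.
  apply: val_inj; have [[CP _] [C'P _]] := (lin_component C, lin_component C').
  have xC' : val x \in val C' by have -> : val x = val x' := xx'; apply: valP.
  exact: component_eq CP C'P (valP x) xC'.
by case: _ / CC' x' xx' => x' /val_inj ->.
Qed.

Lemma lin_basis_surj C x i : C \in components FP -> is_linear (full_subquiver C) ->
  x \in C -> exists b : lin_basis, (lin_vertex b, (tagged b).2) = (x, i).
Proof.
move=> CP lin xC; have CP' : (C \in components FP) && `[< linear_shape (fp_shape C) >].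
  by rewrite CP; apply/asboolP.
by exists (existT _ (Sub C CP' : linear_components F F') ((Sub x xC : full_vertex C), i)).
Qed.

Lemma presentation_linear (N : linear_components F F' -> qmod K Q) :
  (forall C, twisted (N C) (fp_shape (val C)) (fun=> 1%:M : 'M_d)) ->
  presentation (qsum N) (fun b : lin_basis => H (lin_vertex b))
    (fun a b' b => twist_coef H (fun=> 1%:M : 'M_d) a
       (lin_vertex b', (tagged b').2) (lin_vertex b, (tagged b).2)).
Proof.
move=> p; apply: (presentation_relabel (presentation_sum p) (h := id)) => //.
  by exists id.
move=> a [C [x i]] [C' [y j]] _ _; rewrite /lin_vertex /=.
have [CC'|CC'] := eqVneq C C'.
  case: _ / CC' y => y; rewrite (untagE _ _ (erefl : tag (existT _ C (x, i)) = C)) /=.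
  exact/esym/(@twist_coef_component FP H d (fun=> 1%:M) (val C) (fun=> 1%:M)).
rewrite untag_dflt //; have [[CP _] [C'P _]] := (lin_component C, lin_component C').
apply: (twist_coef_separate _ _ _ _ _ CP C'P (valP x) (valP y)).
by move/val_inj => e; rewrite e eqxx in CC'.
Qed.

(** Serves the first three isomorphisms: a gauge turns all matrices into identities, and the basis
    is then sorted by components. *)
Lemma twisted_linear_iso (M : qmod K Q) (D : arrow FP -> 'M[K]_d)
    (N : linear_components F F' -> qmod K Q) :
  twisted M H D -> (forall a, D a \in unitmx) ->
  (forall C, C \in components FP -> is_linear (full_subquiver C)) ->
  (forall C, twisted (N C) (fp_shape (val C)) (fun=> 1%:M : 'M_d)) ->
  qmod_iso M (qsum N).
Proof.
move=> pM Du lin pN; have [T [Tu TD _]] := component_gauge Du.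
apply: presentation_iso (presentation_linear pN).
have pM1 : twisted M H (fun=> 1%:M : 'M_d).
  apply: (twisted_gauge (T := T) (U := fun x => invmx (T x)) _ _ _ pM) => [x|x|a].
  - exact: mulmxV.
  - exact: mulVmx.
  have [C CP aC] := component_of_vertex (qtail a).
  by rewrite mulmx1 (TD C) //; apply: lin.
apply: (presentation_relabel pM1
  (h := fun b : lin_basis => (lin_vertex b, (tagged b).2))) => //.
apply: inj_surj_bijective lin_basis_inj _ => -[x i].
have [C CP xC] := component_of_vertex x.
exact: lin_basis_surj (lin C CP) xC.
Qed.
End LinearComponents.
End LinearPart.

(** * The product of two bands on the same cycle *)

Section SelfTensor.
Variables (K : fieldType) (Q : quiver) (G : qshape Q).
Hypothesis cG : cyclic_shape G.
Local Notation FP := (fibre_product G G).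
Local Notation H := (qhom_comp G (fp_proj1 G G)).

Definition diag_vertex (z : vertex (sdom G)) : vertex FP := Sub (z, z) (eqxx (G z)).
Definition diag_arrow (al : arrow (sdom G)) : arrow FP :=
  Sub (al, al) (eqxx (on_arrow G al)).

Lemma diag_vertexP x : fp_diag x -> x = diag_vertex (val x).1.
Proof.
move=> /eqP dx; apply: val_inj => /=.
by rewrite {2}dx -surjective_pairing.
Qed.

Lemma diag_arrowP (e : arrow FP) : (val e).1 = (val e).2 -> e = diag_arrow (val e).1.
Proof. by move=> ee; apply: val_inj; rewrite /= {2}ee -surjective_pairing. Qed.

Lemma lin_vertex_not_diag d (b : lin_basis G G d) : ~~ fp_diag (lin_vertex b).
Proof.
apply/negP => db; have [CP lin] := lin_component (tag b).
exact: (fp_diag_nonlinear cG CP (lin_vertexP b) db lin).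
Qed.

Lemma not_diag_linear C x : C \in components FP -> x \in C -> ~~ fp_diag x ->
  is_linear (full_subquiver C).
Proof.
move=> CP xC ndx; case: (EM (is_linear (full_subquiver C))) => // nlin.
by rewrite (fp_nonlinear_diag cG CP nlin xC) in ndx.
Qed.

Variables (n : nat) (l : 'I_n -> nat).
Local Notation N := (\sum_k l k)%N.
Variable E : forall k, arrow (sdom G) -> 'M[K]_(l k).

Let D2 (e : arrow FP) : 'M[K]_N :=
  if fp_diag (qtail e) then \mxdiag_k E k (val e).1 else 1%:M.

(** On a linear component [T] trivializes the matrices and [X] only renames coordinates; on the
    diagonal [T] is the identity and [X] brings the matrices to block form. *)
Lemma twisted_self_gauge (M : qmod K Q) (d : nat) (D : arrow FP -> 'M[K]_d)
    (X : 'M[K]_(d, N)) :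
  twisted M H D -> (forall e, D e \in unitmx) -> row_free X -> row_full X ->
  (forall e, (val e).1 = (val e).2 -> D e *m X = X *m \mxdiag_k E k (val e).1) ->
  twisted M H D2.
Proof.
move=> pM Du /row_freeP/cid[Y XY] /row_fullP/cid[Y' Y'X] DX.
(* The two sizes of [X] are different terms, so invertibility comes as one-sided inverses, which
   coincide. *)
have YX : Y *m X = 1%:M.
  by rewrite -[Y]mul1mx -Y'X -(mulmxA Y') XY mulmx1.
have [T [Tu TD T1]] := cid (component_gauge Du).
apply: (twisted_gauge (T := fun x => T x *m X) (U := fun x => Y *m invmx (T x)) _ _ _ pM)
  => [x|x|e].
- by rewrite -mulmxA (mulmxA X) XY mul1mx mulmxV.
- by rewrite -mulmxA (mulmxA (invmx _)) mulVmx // mul1mx YX.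
have [C CP eC] := component_of_vertex (qtail e).
have [lin|nlin] := EM (is_linear (full_subquiver C)).
  rewrite mulmxA (TD C) // /D2 ifN ?mulmx1 //; apply/negP => de.
  exact: (fp_diag_nonlinear cG CP eC de lin).
have de := fp_nonlinear_diag cG CP nlin eC.
have ee : (val e).1 = (val e).2 by apply: fp_diag_arrow; rewrite de.
rewrite (T1 C) // (T1 C (qhead e)) ?component_head // !mul1mx /D2 de.
exact: DX.
Qed.

Lemma mxdiag_Rank (B : forall k, 'M[K]_(l k)) k (r r' : 'I_(l k)) :
  (\mxdiag_k B k) (tagnat.Rank k r) (tagnat.Rank k r') = B k r r'.
Proof. by rewrite -[in RHS](submxblock_diag B k) [RHS]mxE. Qed.

Lemma mxdiag_Rank0 (B : forall k, 'M[K]_(l k)) k k' (r : 'I_(l k)) (r' : 'I_(l k')) :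
  k != k' -> (\mxdiag_k B k) (tagnat.Rank k r) (tagnat.Rank k' r') = 0.
Proof.
move=> kk'; have := mxblockK (fun j k =>
  if j == k then conform_mx 0 (B j) else 0 : 'M_(l j, l k)) k k'.
by rewrite (negPf kk') => /matrixP/(_ r r'); rewrite !mxE.
Qed.

(** By strictness only diagonal arrows join diagonal vertices. *)
Lemma twist_coef_diag a z z' (i j : 'I_N) :
  twist_coef H D2 a (diag_vertex z', j) (diag_vertex z, i) =
  \sum_(al | [&& qtail al == z, qhead al == z' & on_arrow G al == a])
     (\mxdiag_k E k al) j i.
Proof.
rewrite /twist_coef /=.
rewrite (reindex_omap diag_arrow (fun e : fp_arrow G G =>
  if (val e).1 == (val e).2 then Some (val e).1 else None)) /= => [|e]; last first.
  case/and3P=> /eqP ez _ _; have ee : (val e).1 = (val e).2.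
    by case: (congr1 val ez) => t1 t2; apply: fp_diag_arrow; rewrite /fp_diag /= t1 t2 eqxx.
  by rewrite ee eqxx /= -{1}ee -diag_arrowP.
apply: eq_big => [al|al /andP[/and3P[/eqP alz _ _] _]].
  by rewrite !eqxx andbT -!val_eqE /= -!pair_eqE /= !andbb.
by rewrite /D2 /fp_diag /= eqxx.
Qed.

Definition diag_basis : finType := {k : 'I_n & vertex (sdom G) * 'I_(l k)}%type.

Definition self_relabel (b : diag_basis + lin_basis G G N) : vertex FP * 'I_N :=
  match b with
  | inl b => (diag_vertex (tagged b).1, tagnat.Rank (tag b) (tagged b).2)
  | inr b => (lin_vertex b, (tagged b).2)
  end.

(** A vertex lies on a linear component exactly if it is off the diagonal; over the diagonal
    [tagnat.Rank] splits the index into a block and a place in it. *)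
Lemma self_relabel_bij : bijective self_relabel.
Proof.
have notdiag z (b : lin_basis G G N) : diag_vertex z <> lin_vertex b.
  by move=> zb; have := lin_vertex_not_diag b; rewrite -zb /fp_diag /= eqxx.
apply: inj_surj_bijective => [b b' e|[x i]].
  case: b b' e (congr1 fst e) (congr1 snd e) => [[k [z r]]|b] [[k' [z' r']]|b'] /= _.
  - move=> /(congr1 val)[zz' _] /(congr1 val)/eqP.
    rewrite /= tagnat.eq_Rank => /andP[/eqP kk' /eqP rr'].
    by case: _ / kk' r' rr' => r' /val_inj->; rewrite zz'.
  - by move=> zb; case: (notdiag _ _ zb).
  - by move=> /esym zb; case: (notdiag _ _ zb).
  by move=> bb' ii'; congr inr; apply: lin_basis_inj; rewrite bb' ii'.
have [C CP xC] := component_of_vertex x.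
have [dx|ndx] := boolP (fp_diag x); last first.
  have [b bx] := lin_basis_surj i CP (not_diag_linear CP xC ndx) xC.
  by exists (inr b).
exists (inl (existT _ (tagnat.sig1 i) ((val x).1, tagnat.sig2 i))).
by rewrite /= tagnat.sig2K -diag_vertexP.
Qed.

Lemma twisted_self_iso (M : qmod K Q) (d : nat) (D : arrow FP -> 'M[K]_d)
    (X : 'M[K]_(d, N)) (NB : 'I_n -> qmod K Q) (NC : linear_components G G -> qmod K Q) :
  twisted M H D -> (forall e, D e \in unitmx) -> row_free X -> row_full X ->
  (forall e, (val e).1 = (val e).2 -> D e *m X = X *m \mxdiag_k E k (val e).1) ->
  (forall k, twisted (NB k) G (E k)) ->
  (forall C, twisted (NC C) (fp_shape (val C)) (fun=> 1%:M : 'M_N)) ->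
  qmod_iso M (qadd (qsum NB) (qsum NC)).
Proof.
move=> pM Du Xfree Xfull DX pB pC.
have pM2 := twisted_self_gauge pM Du Xfree Xfull DX.
apply: presentation_iso (presentation_add (presentation_sum pB) (presentation_linear pC)).
apply: (presentation_relabel pM2 self_relabel_bij) => [[]|] //.
(* Diagonal vertices and those of linear components lie in different components, so the mixed
   entries vanish. *)
have sep (z : vertex (sdom G)) (b : lin_basis G G N) i j a :
    twist_coef H D2 a (diag_vertex z, j) (lin_vertex b, i) = 0 /\
    twist_coef H D2 a (lin_vertex b, j) (diag_vertex z, i) = 0.
  have [C CP zC] := component_of_vertex (diag_vertex z).
  have [C'P lin] := lin_component (tag b); have bC := lin_vertexP b.
  have zd : fp_diag (diag_vertex z) by rewrite /fp_diag /=.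
  have ne : C <> val (tag b).
    by move=> CC; apply: (fp_diag_nonlinear cG C'P _ zd lin); rewrite -CC.
  split; first by apply: (twist_coef_separate _ _ _ _ _ C'P CP bC zC) => /esym.
  exact: (twist_coef_separate _ _ _ _ _ CP C'P zC bC ne).
move=> a [[k [z r]]|b] [[k' [z' r']]|b'] _ _ /=.
- rewrite twist_coef_diag; have [kk'|kk'] := eqVneq k k'.
    case: _ / kk' r' => r'; rewrite (untagE _ _ (erefl : tag (existT _ k (z, r)) = k)).
    by apply: eq_bigr => al _; rewrite mxdiag_Rank.
  by rewrite untag_dflt // big1 // => al _; rewrite mxdiag_Rank0 1?eq_sym.
- by case: (sep z b' (tagnat.Rank k r) (tagged b').2 a).
- by case: (sep z' b (tagged b).2 (tagnat.Rank k' r') a).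
apply: eq_bigr => e /and3P[/eqP eb _ _].
by rewrite /D2 eb (negPf (lin_vertex_not_diag b)).
Qed.
End SelfTensor.

(** * Kronecker products of band matrices and the four decompositions *)

Section BandTensor.
Variable K : fieldType.

Lemma tensmx11 m n : (1%:M : 'M[K]_m) *t (1%:M : 'M[K]_n) = 1%:M.
Proof.
apply/matrixP => i j; rewrite -[i]mxtens_unindexK -[j]mxtens_unindexK.
case: (mxtens_unindex i) (mxtens_unindex j) => [i1 i2] [j1 j2].
rewrite tensmxE !mxE (inj_eq (can_inj (@mxtens_indexK m n))) -pair_eqE /=.
by rewrite -natrM mulnb.
Qed.

Lemma twist_tens_intertwine (a b : K) (s t : nat) (Z : quiver) (g : arrow Z)
    (p : nat) (l : 'I_p -> nat) (X : 'M[K]_(s * t, \sum_k l k)) al :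
  (jordan a s *t jordan b t) *m X = X *m \mxdiag_k jordan (a * b) (l k) ->
  (band_twist s a g al *t band_twist t b g al) *m X =
  X *m \mxdiag_k band_twist (l k) (a * b) g al.
Proof.
rewrite /band_twist; case: eqP => // _ _.
by rewrite tensmx11 mul1mx mxdiagZ mulmx1.
Qed.
End BandTensor.

Theorem theorem3 (K : closedFieldType) (Q : quiver) (I : ideal K Q)
  (semi_monomial_I : semi_monomial I)
  (F F' G G' : qshape Q)
  (linear_F : linear_shape F) (linear_F' : linear_shape F')
  (cyclic_G : cyclic_shape G) (cyclic_G' : cyclic_shape G')
  (noniso_GG' : ~ shape_iso G G')
  (compat_F : compatible F I) (compat_F' : compatible F' I)
  (compat_G : compatible G I) (compat_G' : compatible G' I)
  (g : arrow (sdom G)) (g' : arrow (sdom G'))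
  (a b : K) (a_neq0 : a != 0) (b_neq0 : b != 0)
  (s t : nat) (s_gt0 : (0 < s)%N) (t_gt0 : (0 < t)%N) :
  [/\ quot_iso I (qtensor (string_mod K F) (string_mod K F'))
        (qsum (fun C : linear_components F F' => string_mod K (fp_shape (val C)))),
      quot_iso I (qtensor (string_mod K F) (band_mod a s g))
        (qsum (fun C : linear_components F G =>
           qcopies s (string_mod K (fp_shape (val C))))),
      quot_iso I (qtensor (band_mod a s g) (band_mod b t g'))
        (qsum (fun C : linear_components G G' =>
           qcopies (s * t) (string_mod K (fp_shape (val C)))))
    & forall l : seq nat, jordan_sizes a b s t l ->
      quot_iso I (qtensor (band_mod a s g) (band_mod b t g))
        (qadd (qsum (fun k : 'I_(size l) => band_mod (a * b) (nth 0%N l k) g))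
              (qsum (fun C : linear_components G G =>
                 qcopies (s * t) (string_mod K (fp_shape (val C))))))].
Proof.
have modF := is_module_push (chi K _) compat_F.
have modF' := is_module_push (chi K _) compat_F'.
have modG := is_module_push (cyclic_mod a s g) compat_G.
have modG2 := is_module_push (cyclic_mod b t g) compat_G.
have modG' := is_module_push (cyclic_mod b t g') compat_G'.
have unit1 : (1%:M : 'M[K]_1) \in unitmx := unitmx1 _ _.
have [s0 t0] : (s != 0 /\ t != 0)%N by rewrite -!lt0n.
split.
- apply: quot_iso_tensor => //.
  apply: (twisted_linear_iso (twisted_tensor (twisted_string K F) (twisted_string K F'))).
  + by move=> e; apply: tensmx_unit.
  + by move=> C; apply: fp_component_linear.
  by move=> C; apply: twisted_string.
- apply: quot_iso_tensor => //.
  apply: (twisted_linear_iso (twisted_tensor (twisted_string K F) (twisted_band a s g))).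
  + by move=> e; apply: tensmx_unit => //; apply: band_twist_unit.
  + by move=> C; apply: fp_component_linear.
  (* The string has matrices of size 1, so the Kronecker products have size [1 * s]. *)
  by move=> C; rewrite -{1}[s]mul1n; apply: twisted_copies.
- apply: quot_iso_tensor => //.
  apply: (twisted_linear_iso (twisted_tensor (twisted_band a s g) (twisted_band b t g'))).
  + by move=> e; apply: tensmx_unit => //; apply: band_twist_unit.
  + by move=> C; apply: fp_noniso_linear.
  by move=> C; apply: twisted_copies.
move=> l [_ _ [X [Xfree Xfull JX]]]; apply: quot_iso_tensor => //.
(* Both ranks of [X] are full, so its two sizes agree; this rewrites the number of copies of each
   string as the size of the block matrices. *)
have stl : (s * t = \sum_(k < size l) nth 0 l k)%N by rewrite -(eqP Xfree) (eqP Xfull).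
rewrite [X in qcopies X]stl.
apply: (twisted_self_iso cyclic_G (E := fun k => band_twist (nth 0%N l k) (a * b) g)
  (twisted_tensor (twisted_band a s g) (twisted_band b t g)) _ Xfree Xfull).
- by move=> e; apply: tensmx_unit => //; apply: band_twist_unit.
- by move=> e /= <-; apply: twist_tens_intertwine JX.
- by move=> k; apply: twisted_band.
by move=> C; apply: twisted_copies.
Qed.
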